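(* Let $(W,\mathcal S)$ be a finite Coxeter system, $\mathsf c$ a Coxeter word and $m\ge 1$. For $m$-factorizations $\mathsf w,\mathsf w'$ of $\mathsf c$, one has $\mathsf w\le\mathsf w'$ in $\mathrm{Camb}^{(m)}(W,\mathsf c)$ if and only if there is a $\mathsf c$-increasing chain from $\mathsf w$ to $\mathsf w'$. Moreover, this can be decided by the greedy algorithm: $\mathsf w\le\mathsf w'$ if and only if the greedy algorithm on input $(\mathsf w,\mathsf w')$ does not abort, and in that case it produces the $\mathsf c$-increasing chain from $\mathsf w$ to $\mathsf w'$.
   Context: Let $\mathcal R$ be the set of reflections (conjugates of elements of $\mathcal S$), $w_\circ$ the longest element of $W$. A Coxeter word $\mathsf c$ is a word in which each element of $\mathcal S$ appears exactly once; $c\in W$ is its product. Reflection order. The $\mathsf c$-sorting word of $w\in W$ is the leftmost subword of $\mathsf c^\infty=\mathsf c\mathsf c\mathsf c\cdots$ that is a reduced word of $w$. Write the $\mathsf c$-sorting word of $w_\circ$ as $\mathsf s_1\cdots\mathsf s_N$ and put $t_i=s_1\cdots s_{i-1}s_is_{i-1}\cdots s_1$. Each reflection is exactly one of the $t_i$. The reflection order is $t_1<_{\mathsf c}\cdots<_{\mathsf c}t_N$, and $\mathsf R(\mathsf c)=\mathsf t_1\cdots\mathsf t_N$. $m$-factorizations. A colored reflection $r^{(i)}$ ($r\in\mathcal R$, $0\le i\le m$) stands for the letter $r$ in the $(i+1)$-st copy of $\mathsf R(\mathsf c)$ in $\mathsf R(\mathsf c)^{m+1}$. Colored reflections are ordered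 by $\le_{\mathsf c}$, first by color and then by the reflection order (i.e. by position in $\mathsf R(\mathsf c)^{m+1}$). An $m$-factorization of $\mathsf c$ is a subword of $\mathsf R(\mathsf c)^{m+1}$ that is a reduced $\mathcal R$-word of $c$ (i.e. $|\mathcal S|$ letters with product $c$); it is regarded as a set of colored reflections. Increasing rotation. If $\mathsf w$ is an $m$-factorization containing $r^{(i)}$ with $i<m$, the increasing rotation of $\mathsf w$ at the rotated reflection $r^{(i)}$ is the $m$-factorization obtained by replacing $r^{(i)}$ by $r^{(i+1)}$ and replacing every colored reflection $t^{(j)}$ of $\mathsf w$ strictly between $r^{(i)}$ and $r^{(i+1)}$ by the unique colored copy of $rtr$ lying strictly between $r^{(i)}$ and $r^{(i+1)}$; all other letters are kept. The $m$-Cambrian lattice $\mathrm{Camb}^{(m)}(W,\mathsf c)$ is the poset on $m$-factorizations whose order is the reflexive transitive closure of increasing rotations; the covers of $\mathsf w$ are exactly its increasing rotations. A $\mathsf c$-increasing chain from $\mathsf w$ to $\mathsf w'$ is a saturated chain $\mathsf w=\mathsf w_0\lessdot\cdots\lessdot\mathsf w_k=\mathsf w'$ ($k\ge0$) of increasing rotations whose successive rotated (colored) reflections are increasing for $<_{\mathsf c}$. Greedy algorithm on $(\mathsf w,\mathsf w')$. Let $M=(m+1)|\mathcal R|$ and let $r_0,\dots,r_{M-1}$ be the colored reflections in the order of the letters of $\mathsf R(\mathsf c)^{m+1}$. Put $\mathsf w_0=\mathsf w$; for $j=0,\dots,M-1$: if $r_j\notin\mathsf w_j\setminus\mathsf w'$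 and $r_j\notin\mathsf w'\setminus\mathsf w_j$, set $\mathsf w_{j+1}=\mathsf w_j$; if $r_j\in\mathsf w_j\setminus\mathsf w'$ and $r_j$ is not of color $m$, let $\mathsf w_{j+1}$ be the increasing rotation of $\mathsf w_j$ at $r_j$; otherwise abort. If it does not abort, the chain produced is the sequence $\mathsf w_0,\dots,\mathsf w_M$ with repetitions removed. *)

(* Defs.v *)
From Stdlib Require Import Relation_Operators.
From HB Require Import structures.
From mathcomp Require Import all_boot all_order all_fingroup.

Set Implicit Arguments.
Unset Strict Implicit.
Unset Printing Implicit Defensive.

Import GroupScope.

(* Products of words are taken from left to right. The presentation of W is
   expressed by its universal property among all groups, finite or not;
   uniqueness of phi follows from <<S>> = [set: W]. Since W is finite, every
   order #[s * t] is finite and every pair (s, t) contributes a relation. *)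
Definition coxeter_system (W : finGroupType) (S : {set W}) : Prop :=
  [/\ <<S>> = [set: W],
      {in S, forall s, #[s] = 2%N} &
      forall (H : groupType) (f : W -> H),
        {in S &, forall s t, (f s * f t) ^+ #[s * t] = 1} ->
        exists phi : {multiplicative W -> H}, {in S, phi =1 f}].

Definition reduced_word (W : finGroupType) (A : {set W}) (x : W) (u : seq W) :
    Prop :=
  [/\ {subset u <= A},
      \prod_(a <- u) a = x &
      forall v : seq W, {subset v <= A} -> \prod_(a <- v) a = x ->
        size u <= size v].

Definition reflections (W : finGroupType) (S : {set W}) : {set W} :=
  class_support S [set: W].

Definition longest_element (W : finGroupType) (S : {set W}) (w0 : W) : Prop :=
  exists2 u, reduced_word S w0 u &
    forall (x : W) (v : seq W), reduced_word S x v -> size v <= size u.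

Definition coxeter_word (W : finGroupType) (S : {set W}) (cw : seq W) : Prop :=
  uniq cw /\ cw =i S.

(* The letter of cw cw cw ... at position p. *)
Definition cinf (W : finGroupType) (cw : seq W) (p : nat) : W :=
  nth 1 cw (p %% size cw).

(* Subwords of cw cw cw ... are given by increasing sequences of positions, and
   the leftmost one has the lexicographically smallest such sequence. *)
Definition sorting_word (W : finGroupType) (S : {set W}) (cw : seq W) (x : W)
    (u : seq W) : Prop :=
  exists ps : seq nat,
    [/\ sorted ltn ps,
        u = map (cinf cw) ps,
        reduced_word S x u &
        forall qs : seq nat, sorted ltn qs ->
          reduced_word S x (map (cinf cw) qs) ->
          (ps <= qs :> Order.SeqLexiOrder.Exports.seqlexi nat)%O].

(* For u = s_1 ... s_N, the word t_1 ... t_N with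
   t_i = s_1 ... s_(i-1) s_i s_(i-1) ... s_1. *)
Definition reflection_word (W : finGroupType) (u : seq W) : seq W :=
  [seq (\prod_(s <- take i u) s) * nth 1 u i * (\prod_(s <- rev (take i u)) s)
     | i <- iota 0 (size u)].

Section Factorizations.

Variables (W : finGroupType) (S : {set W}) (cw : seq W).
(* Rc stands for the word R(c), that is, the reflection word of the c-sorting
   word of the longest element. *)
Variables (Rc : seq W) (m : nat).


(* The pair (i, r) is the colored reflection r^(i); these are the letters of
   R(c)^(m+1), from left to right. *)
Definition colored_word : seq ('I_m.+1 * W) :=
  [seq (i, r) | i <- enum 'I_m.+1, r <- Rc].

Definition colored_lt (a b : 'I_m.+1 * W) : bool :=
  index a colored_word < index b colored_word.

Definition factorization (X : {set 'I_m.+1 * W}) : Prop :=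
  {subset X <= colored_word} /\
  reduced_word (reflections S) (\prod_(s <- cw) s)
    [seq a.2 | a <- colored_word & a \in X].

(* r^(i+1); only meaningful when i < m. *)
Definition recolor (a : 'I_m.+1 * W) : 'I_m.+1 * W := (inord a.1.+1, a.2).

Definition inside (a b : 'I_m.+1 * W) : bool :=
  colored_lt a b && colored_lt b (recolor a).

(* Every reflection other than r has exactly one colored copy strictly between
   r^(i) and r^(i+1), so the last set below has one element for each letter of X
   in that range. *)
Definition rotate (X : {set 'I_m.+1 * W}) (a : 'I_m.+1 * W) :
    {set 'I_m.+1 * W} :=
  recolor a
    |: [set b in X | (b != a) && ~~ inside a b]
   :|: [set b | inside a b &
          [exists d in X, inside a d && (b.2 == a.2 * d.2 * a.2)]].

Definition increasing_rotation (X : {set 'I_m.+1 * W}) (a : 'I_m.+1 * W)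
    (Y : {set 'I_m.+1 * W}) : Prop :=
  [/\ factorization X, factorization Y, a \in X, a.1 < m & Y = rotate X a].

Definition camb_le : {set 'I_m.+1 * W} -> {set 'I_m.+1 * W} -> Prop :=
  clos_refl_trans _ (fun X Y => exists a, increasing_rotation X a Y).

Fixpoint rotation_path (X : {set 'I_m.+1 * W}) (rs : seq ('I_m.+1 * W))
    (Zs : seq {set 'I_m.+1 * W}) : Prop :=
  match rs, Zs with
  | [::], [::] => True
  | r :: rs', Z :: Zs' => increasing_rotation X r Z /\ rotation_path Z rs' Zs'
  | _, _ => False
  end.

(* Xs lists the whole chain, both ends included. *)
Definition increasing_chain (X Y : {set 'I_m.+1 * W})
    (Xs : seq {set 'I_m.+1 * W}) : Prop :=
  exists (rs : seq ('I_m.+1 * W)) (Zs : seq {set 'I_m.+1 * W}),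
    [/\ Xs = X :: Zs, last X Zs = Y, rotation_path X rs Zs &
        sorted colored_lt rs].

(* None means that the algorithm aborts. *)
Definition greedy_step (X Y : {set 'I_m.+1 * W}) (r : 'I_m.+1 * W) :
    option {set 'I_m.+1 * W} :=
  if (r \notin X :\: Y) && (r \notin Y :\: X) then Some X
  else if (r \in X :\: Y) && (r.1 < m) then Some (rotate X r)
  else None.

Fixpoint greedy_run (X Y : {set 'I_m.+1 * W}) (rs : seq ('I_m.+1 * W)) :
    option (seq {set 'I_m.+1 * W}) :=
  if rs is r :: rs' then
    if greedy_step X Y r is Some X' then omap (cons X) (greedy_run X' Y rs')
    else None
  else Some [:: X].

Definition greedy (X Y : {set 'I_m.+1 * W}) : option (seq {set 'I_m.+1 * W}) :=
  omap undup (greedy_run X Y colored_word).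

End Factorizations.

(* Main.v *)
(* In the geometric representation of W, a Coxeter element c has no nonzero fixed
   vector, and the form E(x, y) = 2 B(x, (1 - c)^-1 y) satisfies
   E(x, y) + E(y, x) = 2 B(x, y). A sequence of n = #|S| reflections has product c
   if and only if E is triangular on its roots. The letters of ccc... that the
   sorting word of w0 skips commute with all the later letters that it keeps;
   hence the roots of R(c) come in an order for which E(b, b') <= 0 <= E(b', b)
   whenever b precedes b'.

   Give the copies of R(c) in R(c)^(m+1) alternating signs and write
   hom(a, b) = E(b, a) for two colored reflections, seen as signed roots. Then an
   m-factorization is a set X of n letters with hom(a, b) = 0 for a before b, and
   b goes to b - hom(b, a) a inside the window when X is rotated at a. Say that
   X precedes Y when hom(y, x) = 0 for all x in X and y in Y such that x is at
   least one full turn after y. This relation is implied by X <= Y, by descending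
   induction along a chain of rotations. Conversely, if X precedes Y, expanding a
   root over a factorization and comparing signs shows that the first letter
   where X and Y differ is in X, is not of color m, and that rotating X there
   preserves the relation: this is one step of the greedy algorithm. *)
From Stdlib Require Import Relation_Operators.
Require Import Defs.
From HB Require Import structures.
From mathcomp Require Import all_boot all_order all_fingroup all_algebra.
From mathcomp Require Import reals Rstruct trigo.
From mathcomp Require Import ring lra zify.

Set Implicit Arguments.
Unset Strict Implicit.
Unset Printing Implicit Defensive.

Import Order.TTheory GRing.Theory Num.Theory.

(** * Reflections and the Euler form of a product of reflections *)

(** A chain witnessing X <= Y may rotate its letters in any order, so it says nothing direct about
    the first letter where X and Y differ. Hence the detour through a relation that mentions no
    chain: it passes backward along arbitrary rotations and forward along greedy ones. To have
    product c is a condition on ordered sequences of reflections, and B, being symmetric, does not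
    see the order; E turns the condition into the vanishing of numbers whose signs are controlled by
    the reflection order. The model is the derived category of a hereditary algebra, with E as Euler
    form, a full turn of R(c) as shift and factorizations as simple-minded collections; only its
    numerical shadow is kept, so that all finite types are treated alike. As W is given by a
    universal property and R(c) by a lexicographic minimum, the geometry has to be built: the
    representation from a map into GL_n, the positivity of roots from the length function, and R(c)
    from the signs of the roots at the positions of c c c ... *)

Section BilinearForm.
Local Open Scope ring_scope.
Variables (R : realFieldType) (n : nat) (G : 'M[R]_n).
Hypothesis G_sym : G^T = G.
Implicit Types (x y z b : 'cV[R]_n) (bs : seq 'cV[R]_n).

Definition gdot x y : R := (x^T *m G *m y) 0 0.

Lemma dotC x y : gdot x y = gdot y x.
Proof.
have tr00 (A : 'M[R]_1) : A^T 0 0 = A 0 0 by rewrite mxE.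
by rewrite /gdot -tr00 !trmx_mul trmxK G_sym mulmxA.
Qed.

Lemma dotDr x y z : gdot x (y + z) = gdot x y + gdot x z.
Proof. by rewrite /gdot mulmxDr mxE. Qed.

Lemma dotZr a x y : gdot x (a *: y) = a * gdot x y.
Proof. by rewrite /gdot -scalemxAr mxE. Qed.

Lemma dotNr x y : gdot x (- y) = - gdot x y.
Proof. by rewrite -scaleN1r dotZr mulN1r. Qed.

Lemma dotBr x y z : gdot x (y - z) = gdot x y - gdot x z.
Proof. by rewrite dotDr dotNr. Qed.

Lemma dot0r x : gdot x 0 = 0.
Proof. by rewrite /gdot mulmx0 mxE. Qed.

Lemma dotDl x y z : gdot (y + z) x = gdot y x + gdot z x.
Proof. by rewrite !(dotC _ x) dotDr. Qed.

Lemma dotZl a x y : gdot (a *: y) x = a * gdot y x.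
Proof. by rewrite !(dotC _ x) dotZr. Qed.

Lemma dotBl x y z : gdot (y - z) x = gdot y x - gdot z x.
Proof. by rewrite !(dotC _ x) dotBr. Qed.

Lemma dot0l x : gdot 0 x = 0.
Proof. by rewrite dotC dot0r. Qed.

(** A reflection for unit vectors b only: there is no division by [gdot b b]. *)
Definition gsref b x := x - (2 * gdot b x) *: b.

Lemma sref_is_linear b : linear (gsref b).
Proof.
move=> a x y; rewrite /gsref dotDr dotZr scalerBr !scalerA.
rewrite addrACA -opprD -scalerDl; congr (_ - _ *: _); ring.
Qed.

Lemma sref_dot b x y : gdot b b = 1 -> gdot (gsref b x) (gsref b y) = gdot x y.
Proof.
move=> b1; rewrite /gsref dotBl !dotBr !dotZl !dotZr b1 (dotC x b).
ring.
Qed.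

Lemma srefK b : gdot b b = 1 -> involutive (gsref b).
Proof.
move=> b1 x; rewrite {1}/gsref /gsref dotBr dotZr b1 -addrA -opprD -scalerDl.
by rewrite [X in X *: _](_ : _ = 0) ?scale0r ?subr0 //; ring.
Qed.

Lemma sref_conj b d x : gdot b b = 1 ->
  gsref (gsref b d) x = gsref b (gsref d (gsref b x)).
Proof.
move=> b1; rewrite [gsref d _]/gsref -scaleNr addrC sref_is_linear srefK //.
by rewrite -(sref_dot d _ b1) srefK // addrC scaleNr.
Qed.

Lemma foldr_sref_fix bs z :
  {in bs, forall b, gdot b z = 0} -> foldr gsref z bs = z.
Proof.
elim: bs => //= b bs IH bz; rewrite IH => [|d d_bs]; last first.
  by apply: bz; rewrite inE d_bs orbT.
by rewrite /gsref bz ?mem_head // mulr0 scale0r subr0.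
Qed.

Lemma foldr_sref_linear bs : linear (fun x => foldr gsref x bs).
Proof.
by elim: bs => //= b bs IH a x y; rewrite IH sref_is_linear.
Qed.

Lemma foldr_srefB bs x y :
  foldr gsref (x - y) bs = foldr gsref x bs - foldr gsref y bs.
Proof.
by rewrite -!scaleN1r addrC (foldr_sref_linear bs) addrC.
Qed.

(** A row vector times this matrix lists its scalar products with the members of [bs]. If [bs] has
    fewer than n members, the default value 0 adds zero columns, which make the matrix singular in
    [exists_orthogonal]. *)
Definition gram_cols bs : 'M[R]_n := \matrix_(i, j) (G *m nth 0 bs j) i 0.

Lemma gram_colsE bs (v : 'rV[R]_n) (j : 'I_n) :
  (v *m gram_cols bs) 0 j = gdot (nth 0 bs j) v^T.
Proof.
rewrite dotC /gdot trmxK -mulmxA !mxE; apply: eq_bigr => i _.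
by rewrite !mxE.
Qed.

Lemma gram_cols_unit bs : size bs = n ->
  (forall x, {in bs, forall b, gdot b x = 0} -> x = 0) ->
  gram_cols bs \in unitmx.
Proof.
move=> sz_bs bs_full; rewrite unitmxE unitfE.
apply/negP => /det0P[v vN0 vA0]; case/negP: vN0.
rewrite -(inj_eq trmx_inj) trmx0; apply/eqP/bs_full => b b_bs.
have ltbn : (index b bs < n)%N.
  by move: b_bs; rewrite -index_mem => /leq_trans; apply; rewrite sz_bs.
have := congr1 (fun A : 'rV[R]_n => A 0 (Ordinal ltbn)) vA0.
by rewrite gram_colsE mxE /= nth_index.
Qed.

Lemma exists_dual bs (f : nat -> R) : size bs = n ->
  (forall x, {in bs, forall b, gdot b x = 0} -> x = 0) ->
  exists z, forall i, (i < n)%N -> gdot (nth 0 bs i) z = f i.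
Proof.
move=> sz_bs /(gram_cols_unit sz_bs) A_unit.
exists ((\row_j f j) *m invmx (gram_cols bs))^T => i ltin.
have := gram_colsE bs ((\row_j f j) *m invmx (gram_cols bs)) (Ordinal ltin).
by rewrite mulmxKV // mxE => <-.
Qed.

Lemma exists_orthogonal bs : (size bs < n)%N ->
  exists2 x, x != 0 & {in bs, forall b, gdot b x = 0}.
Proof.
move=> lt_bs_n; have: \det (gram_cols bs) == 0.
  rewrite -[_ == 0]negbK -unitfE -unitmxE -row_full_unit.
  apply/negP => /row_fullP[B BA]; pose j := Ordinal lt_bs_n.
  have := gram_colsE bs (row j B) j.
  rewrite -row_mul BA nth_default // dot0l !mxE eqxx => /eqP.
  by rewrite oner_eq0.
case/det0P=> v vN0 vA0; exists v^T.
  by rewrite -(inj_eq trmx_inj) trmxK trmx0.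
move=> b b_bs.
have ltbn : (index b bs < n)%N := leq_ltn_trans (index_size _ _) lt_bs_n.
have := congr1 (fun A : 'rV[R]_n => A 0 (Ordinal ltbn)) vA0.
by rewrite gram_colsE mxE /= nth_index.
Qed.

Section Euler.

Variable C : 'M[R]_n.
Hypothesis C_fix : forall x, C *m x = x -> x = 0.
Hypothesis C_dot : forall x y, gdot (C *m x) (C *m y) = gdot x y.

Lemma euler_unit : 1%:M - C \in unitmx.
Proof.
rewrite -unitmx_tr unitmxE unitfE.
apply/negP => /det0P[v vN0 vA0]; case/negP: vN0.
rewrite -(inj_eq trmx_inj) trmx0; apply/eqP/C_fix.
have := congr1 trmx vA0; rewrite trmx_mul trmxK mulmxBl mul1mx trmx0.
by move/eqP; rewrite subr_eq0 => /eqP.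
Qed.

(* The Euler form of C: over a basis of simple roots with product C it is the
   unitriangular matrix whose symmetrization is twice the Gram matrix. *)
Definition euler x y := 2 * gdot x (invmx (1%:M - C) *m y).

Lemma sub1mx_mul (x : 'cV[R]_n) : (1%:M - C) *m x = x - C *m x.
Proof. by rewrite mulmxBl mul1mx. Qed.

Lemma eulerE x z : euler x (z - C *m z) = 2 * gdot x z.
Proof.
by rewrite /euler -sub1mx_mul mulKmx // euler_unit.
Qed.

Lemma euler_preim x : exists z, x = z - C *m z.
Proof.
exists (invmx (1%:M - C) *m x).
by rewrite -sub1mx_mul mulKVmx // euler_unit.
Qed.

Lemma eulerDr x y z : euler x (y + z) = euler x y + euler x z.
Proof. by rewrite /euler mulmxDr dotDr mulrDr. Qed.

Lemma eulerZr a x y : euler x (a *: y) = a * euler x y.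
Proof. by rewrite /euler -scalemxAr dotZr mulrCA. Qed.

Lemma eulerDl x y z : euler (y + z) x = euler y x + euler z x.
Proof. by rewrite /euler dotDl mulrDr. Qed.

Lemma eulerZl a x y : euler (a *: x) y = a * euler x y.
Proof. by rewrite /euler dotZl mulrCA. Qed.

(** With x = u - C u and y = v - C v, both sides expand to the same expression because C preserves
    the scalar product. *)
Lemma euler_sym x y : euler x y + euler y x = 2 * gdot x y.
Proof.
have [u ->] := euler_preim x; have [v ->] := euler_preim y.
rewrite !eulerE !dotBl !dotBr C_dot (dotC v u) (dotC (C *m v) u).
ring.
Qed.

Lemma euler1 x : gdot x x = 1 -> euler x x = 1.
Proof. by move=> x1; have := euler_sym x x; rewrite x1; lra. Qed.

Section Factor.
Variable bs : seq 'cV[R]_n.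
Hypothesis bs1 : {in bs, forall b, gdot b b = 1}.
Hypothesis sz_bs : size bs = n.

Lemma sref_prod_full (bsC : forall x, foldr gsref x bs = C *m x) x :
  {in bs, forall b, gdot b x = 0} -> x = 0.
Proof. by move=> bx; apply: C_fix; rewrite -bsC foldr_sref_fix. Qed.

(** Only one reflection moves anything: z is orthogonal to the later members of [bs], the reflection
    in the i-th one sends z to z minus that vector, and the result is orthogonal to the earlier
    members. When [bs] has product C, such a z is the preimage of the i-th vector under 1 - C. *)
Lemma euler_col (i : nat) z : (i < n)%N ->
  (forall j, (i < j < n)%N -> gdot (nth 0 bs j) z = 0) ->
  2 * gdot (nth 0 bs i) z = 1 ->
  (forall j, (j < i)%N -> gdot (nth 0 bs j) z = gdot (nth 0 bs j) (nth 0 bs i)) ->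
  foldr gsref z bs = z - nth 0 bs i.
Proof.
move=> ltin gt_i eq_i lt_i.
have lt_i_bs : (i < size bs)%N by rewrite sz_bs.
rewrite -[in foldr _ _ _](cat_take_drop i bs) (drop_nth 0 lt_i_bs) foldr_cat /=.
rewrite (@foldr_sref_fix (drop i.+1 bs)) => [|b]; last first.
  case/(nthP 0) => k; rewrite size_drop sz_bs nth_drop => lt_k <-.
  by apply: gt_i; rewrite leq_addr /= -ltn_subRL.
rewrite [gsref _ z]/gsref eq_i scale1r foldr_sref_fix // => b.
case/(nthP 0) => k; rewrite size_takel ?(ltnW lt_i_bs) // => lt_k <-.
by rewrite nth_take // dotBr lt_i // subrr.
Qed.

Lemma euler_factor (bsC : forall x, foldr gsref x bs = C *m x) i j :
  (i < j < n)%N -> euler (nth 0 bs j) (nth 0 bs i) = 0.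
Proof.
case/andP=> ltij ltjn; have ltin := ltn_trans ltij ltjn.
(* These are the scalar products that [euler_col] asks of z. *)
pose f k := if (i < k)%N then 0 else
  if k == i then 2^-1 else gdot (nth 0 bs k) (nth 0 bs i).
have [z zE] := exists_dual f sz_bs (sref_prod_full bsC).
have bsz : foldr gsref z bs = z - nth 0 bs i.
  apply: euler_col => // [k /andP[ltik ltkn]||k ltki].
  - by rewrite zE // /f ltik.
  - by rewrite zE // /f ltnn eqxx divff ?pnatr_eq0.
  by rewrite zE ?(ltn_trans ltki) // /f ltnNge (ltnW ltki) /= ltn_eqF.
have -> : nth 0 bs i = z - C *m z by rewrite -bsC bsz opprB addrC subrK.
by rewrite eulerE zE // /f ltij mulr0.
Qed.

Hypothesis bs_tri : forall i j, (i < j < n)%N ->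
  euler (nth 0 bs j) (nth 0 bs i) = 0.

Let bs_nth1 (i : nat) : (i < n)%N -> gdot (nth 0 bs i) (nth 0 bs i) = 1.
Proof. by move=> ltin; apply: bs1; rewrite mem_nth // sz_bs. Qed.

(** The matrix of E on [bs], twice the matrix A below, is triangular with ones on the diagonal.
    Since A has Q, the matrix with columns [bs], as a factor, Q is invertible. *)
Lemma triangular_span u :
  exists c : nat -> R, u = \sum_(i < n) c i *: nth 0 bs i.
Proof.
pose Q : 'M[R]_n := \matrix_(i, j) nth 0 bs j i 0.
have colQ (j : 'I_n) : col j Q = nth 0 bs j.
  by apply/colP => i; rewrite !mxE.
pose A := Q^T *m (G *m invmx (1%:M - C) *m Q).
have AE (i j : 'I_n) : 2 * A i j = euler (nth 0 bs i) (nth 0 bs j).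
  rewrite /euler /gdot -!colQ; congr (_ * _).
  have -> : A i j = (row i (col j A)) 0 0 by rewrite !mxE.
  by rewrite /A colE -!mulmxA -colE row_mul -tr_col.
have Q_unit : Q \in unitmx.
  rewrite -unitmx_tr; suff: A \in unitmx by rewrite unitmx_mul => /andP[].
  have A_trig : is_trig_mx A^T.
    apply/is_trig_mxP => i j ltij; rewrite mxE.
    by have := AE j i; rewrite bs_tri ?ltij ?ltn_ord //; lra.
  rewrite -unitmx_tr unitmxE (det_trig A_trig) unitfE.
  apply/prodf_neq0 => i _; rewrite mxE; have := AE i i; rewrite euler1 ?bs_nth1 //.
  by case: eqP => // ->; lra.
exists (fun k => if insub k is Some i then (invmx Q *m u) i 0 else 0).
rewrite -[LHS](mulKVmx Q_unit); apply/colP => i.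
rewrite summxE mxE; apply: eq_bigr => j _.
by rewrite valK [RHS]mxE [Q i j]mxE mulrC.
Qed.

(** Both sides are linear, and the preimages z_i of the b_i under 1 - C span the space because the
    b_i do. On z_i, [euler_col] computes the product of the reflections as z_i - b_i, which is C
    z_i. *)
Lemma triangular_prod x : foldr gsref x bs = C *m x.
Proof.
have [c cE] := triangular_span (x - C *m x).
pose z (i : 'I_n) := invmx (1%:M - C) *m nth 0 bs i.
have zE (i : 'I_n) : nth 0 bs i = z i - C *m z i.
  by rewrite -sub1mx_mul mulKVmx // euler_unit.
have -> : x = \sum_(i < n) c i *: z i.
  set y := \sum_(i < n) _; have yE : y - C *m y = x - C *m x.
    rewrite cE mulmx_sumr -sumrB; apply: eq_bigr => i _.
    by rewrite -scalemxAr -scalerBr -zE.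
  apply/eqP; rewrite -subr_eq0; apply/eqP/C_fix.
  by rewrite mulmxBr -(subKr x (C *m x)) -yE opprB addrA addrAC addrK.
pose P y := foldr gsref y bs = C *m y.
apply: (@big_ind _ P) => [|u v Pu Pv|i _].
- by rewrite /P mulmx0; have := foldr_srefB bs 0 0; rewrite !subr0 subrr.
- rewrite /P mulmxDr -Pu -Pv -[u]scale1r (foldr_sref_linear bs 1 u v).
  by rewrite !scale1r.
rewrite /P -[_ *: _]addr0 (foldr_sref_linear bs) (@foldr_sref_fix bs 0).
  rewrite !addr0 -scalemxAr; congr (_ *: _).
  rewrite (@euler_col i) //.
  - by rewrite zE subKr.
  - by move=> j ltijn; have := bs_tri ltijn; rewrite zE eulerE; lra.
  - by have := euler1 (bs_nth1 (ltn_ord i)); rewrite {2}zE eulerE.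
  move=> j ltji; have := euler_sym (nth 0 bs j) (nth 0 bs i).
  by rewrite {1}zE eulerE bs_tri ?ltji ?ltn_ord //; lra.
by move=> b _; rewrite dot0r.
Qed.

End Factor.
End Euler.
End BilinearForm.

(** * The geometric representation *)

Section Dihedral.
Local Open Scope ring_scope.
Variables (R : realType) (n : nat) (G : 'M[R]_n) (m : nat).
Hypotheses (G_sym : G^T = G) (m_gt1 : (1 < m)%N).
Let theta : R := pi / m%:R.
Local Notation dot := (gdot G).
Local Notation sref := (gsref G).

Let m_gt0 : 0 < m%:R :> R.
Proof. by rewrite ltr0n (ltn_trans _ m_gt1). Qed.

Let m_theta : m%:R * theta = pi.
Proof. by rewrite mulrC divfK // gt_eqF. Qed.

Let theta_gt0 : 0 < theta.
Proof. by rewrite divr_gt0 // pi_gt0. Qed.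

Lemma sin_theta_gt0 : 0 < sin theta.
Proof.
apply: sin_gt0_pi; rewrite theta_gt0 /= -[ltRHS]m_theta ltr_pMl //.
by rewrite ltr1n.
Qed.

Lemma sin_mul_theta_ge0 k : (k <= m)%N -> 0 <= sin (k%:R * theta).
Proof.
move=> le_km; apply: sin_ge0_pi; apply/andP; split.
  by rewrite mulr_ge0 ?ler0n // ltW.
by rewrite -[leRHS]m_theta ler_pM2r // ler_nat.
Qed.

Lemma sin_theta_rec k : sin (k.+2%:R * theta) =
  2 * cos theta * sin (k.+1%:R * theta) - sin (k%:R * theta).
Proof.
have -> : k.+2%:R * theta = k.+1%:R * theta + theta by rewrite -natr1; ring.
have -> : k%:R * theta = k.+1%:R * theta - theta by rewrite -natr1; ring.
by rewrite sinD sinB; ring.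
Qed.

(** The roots of a dihedral group: alternating reflections in x and y, applied to x, run through
    these combinations with the roles of x and y exchanged at each step. *)
Definition dihedral_root k (x y : 'cV[R]_n) :=
  (sin (k.+1%:R * theta) / sin theta) *: x + (sin (k%:R * theta) / sin theta) *: y.

Lemma dihedral_root0 x y : dihedral_root 0 x y = x.
Proof.
rewrite /dihedral_root mul1r mul0r sin0 mul0r scale0r addr0 divff ?scale1r //.
by rewrite gt_eqF ?sin_theta_gt0.
Qed.

Lemma sref_dihedral_root k x y : dot y y = 1 -> dot y x = - cos theta ->
  sref y (dihedral_root k x y) = dihedral_root k.+1 y x.
Proof.
move=> y1 yx; rewrite /dihedral_root /sref dotDr !dotZr y1 yx sin_theta_rec.
rewrite -addrA -scalerBl addrC; congr (_ *: _ + _).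
by ring.
Qed.

Variables a b : 'cV[R]_n.
Hypotheses (a1 : dot a a = 1) (b1 : dot b b = 1) (ab : dot a b = - cos theta).
Let ba : dot b a = - cos theta. Proof. by rewrite dotC. Qed.

Let T x := sref a (sref b x).

Let T_lin : linear T.
Proof. by move=> c x y; rewrite /T !sref_is_linear. Qed.

Let iter_T_lin k : linear (iter k T).
Proof. by elim: k => [|k IH] c x y /=; last by rewrite IH T_lin. Qed.

Let T_dihedral k c : T (c *: dihedral_root k a b) = c *: dihedral_root k.+2 a b.
Proof.
rewrite -[in LHS](addr0 (c *: _)) T_lin /T !sref_dihedral_root //.
by rewrite /sref !dot0r !mulr0 !scale0r !subr0 dot0r mulr0 scale0r subr0 addr0.
Qed.

Let iter_T_dihedral k j c :
  iter k T (c *: dihedral_root j a b) = c *: dihedral_root (k.*2 + j) a b.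
Proof. by elim: k => // k IH; rewrite iterS IH T_dihedral. Qed.

Let iter_T_a : iter m T a = a.
Proof.
rewrite -[a in iter _ _ a](dihedral_root0 a b) -[dihedral_root 0 a b]scale1r.
rewrite iter_T_dihedral scale1r /dihedral_root addn0.
have e : m.*2%:R * theta = pi *+ 2 by rewrite -mul2n natrM -mulrA m_theta mulr_natl.
rewrite e sin2pi mul0r scale0r addr0.
rewrite -natr1 mulrDl e mul1r addrC sinD2pi.
by rewrite divff ?scale1r // gt_eqF ?sin_theta_gt0.
Qed.

Let iter_T_b : iter m T b = b.
Proof.
have e : m.*2%:R * theta = pi *+ 2 by rewrite -mul2n natrM -mulrA m_theta mulr_natl.
have Tb : T b = -1 *: dihedral_root 1 a b.
  rewrite /T {2}/sref b1 mulr1 (_ : 2 = 1 + 1) // scalerDl scale1r opprD addrA.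
  rewrite subrr add0r -sref_dihedral_root // dihedral_root0 scaleN1r.
  by rewrite /sref dotNr mulrN scaleNr opprK opprB addrC.
have -> : m = m.-1.+1 by rewrite prednK // (ltn_trans _ m_gt1).
rewrite iterSr Tb iter_T_dihedral.
have em : (m.-1.*2 + 1 = m.*2.-1)%N.
  by case: m m_gt1 => // k _; rewrite doubleS addn1.
rewrite em /dihedral_root.
have -> : m.*2.-1%:R * theta = - theta + pi *+ 2.
  rewrite -e; have -> : m.*2%:R = m.*2.-1%:R + 1 :> R.
    by rewrite natr1 prednK // double_gt0 (ltn_trans _ m_gt1).
  by ring.
rewrite prednK ?double_gt0 ?(ltn_trans _ m_gt1) // e sin2pi mul0r scale0r add0r.
rewrite sinD2pi sinN mulNr divff ?gt_eqF ?sin_theta_gt0 //.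
by rewrite scalerA mulrNN mulr1 scale1r.
Qed.

(** On the plane of a and b, T raises the index of a dihedral root by 2, so m applications turn by
    the angle 2 pi; the orthogonal complement is fixed. *)
Lemma sref_dihedral_order x : iter m (fun x => sref a (sref b x)) x = x.
Proof.
rewrite -[iter _ _ _]/(iter m T x).
have s_neq0 : 1 - cos theta ^+ 2 != 0.
  by rewrite -sin2cos2 expf_neq0 // gt_eqF ?sin_theta_gt0.
(* p and q solve the linear system that makes y orthogonal to a and b; the denominator is its Gram
   determinant. *)
pose p := (dot a x + cos theta * dot b x) / (1 - cos theta ^+ 2).
pose q := (dot b x + cos theta * dot a x) / (1 - cos theta ^+ 2).
pose y := x - p *: a - q *: b.
have ay : dot a y = 0.
  by rewrite /y !dotBr !dotZr a1 ab /p /q; field.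
have by0 : dot b y = 0.
  by rewrite /y !dotBr !dotZr b1 ba /p /q; field.
have Ty k : iter k T y = y.
  elim: k => // k IH; rewrite iterS IH /T /sref.
  by rewrite by0 mulr0 scale0r subr0 ay mulr0 scale0r subr0.
have -> : x = p *: a + (q *: b + y).
  by rewrite /y (addrC (q *: b)) subrK addrC subrK.
by rewrite iter_T_lin iter_T_a iter_T_lin iter_T_b Ty.
Qed.

End Dihedral.

(** * The general linear group *)

Section GeneralLinearGroup.
Local Open Scope ring_scope.
Variables (R : fieldType) (n : nat).

(** The target to which the universal property of W is applied; over the reals it is an infinite
    group. *)
Definition gl := {A : 'M[R]_n | A \in unitmx}.

HB.instance Definition _ := Choice.on gl.

Fact gl_one_subproof : (1%:M : 'M[R]_n) \in unitmx.
Proof. exact: unitmx1. Qed.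
Definition gl_one : gl := exist _ 1%:M gl_one_subproof.

Fact gl_mul_subproof (A B : gl) : val A *m val B \in unitmx.
Proof. by rewrite unitmx_mul (valP A) (valP B). Qed.
Definition gl_mul A B : gl := exist _ (val A *m val B) (gl_mul_subproof A B).

Fact gl_inv_subproof (A : gl) : invmx (val A) \in unitmx.
Proof. by rewrite unitmx_inv (valP A). Qed.
Definition gl_inv A : gl := exist _ (invmx (val A)) (gl_inv_subproof A).

Fact gl_mulA : associative gl_mul.
Proof. by move=> A B C; apply: val_inj; rewrite /= mulmxA. Qed.
Fact gl_mul1 : left_id gl_one gl_mul.
Proof. by move=> A; apply: val_inj; rewrite /= mul1mx. Qed.
Fact gl_mulr1 : right_id gl_one gl_mul.
Proof. by move=> A; apply: val_inj; rewrite /= mulmx1. Qed.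
Fact gl_mulV : left_inverse gl_one gl_inv gl_mul.
Proof. by move=> A; apply: val_inj; rewrite /= mulVmx // (valP A). Qed.
Fact gl_mulrV : right_inverse gl_one gl_inv gl_mul.
Proof. by move=> A; apply: val_inj; rewrite /= mulmxV // (valP A). Qed.

HB.instance Definition _ :=
  isGroup.Build gl gl_mulA gl_mul1 gl_mulr1 gl_mulV gl_mulrV.

Lemma val_glX (A B : gl) k (x : 'cV[R]_n) :
  val ((A * B) ^+ k)%g *m x = iter k (fun y => val A *m (val B *m y)) x.
Proof.
elim: k => [|k IH]; first by rewrite expg0 mul1mx.
by rewrite expgS iterS -IH !mulmxA.
Qed.

Lemma eq_mulmx_cV (A B : 'M[R]_n) :
  (forall x : 'cV[R]_n, A *m x = B *m x) -> A = B.
Proof.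
move=> AB; apply/matrixP => i j; have := AB (delta_mx j 0).
by rewrite -!colE => /colP/(_ i); rewrite !mxE.
Qed.

End GeneralLinearGroup.

Section SimpleReflections.
Local Open Scope ring_scope.
Variables (R : realType) (W : finGroupType) (S : {set W}) (cw : seq W).
Hypotheses (WS : coxeter_system S) (cwS : coxeter_word S cw).

Definition rank := size cw.
Definition gen i : W := nth 1%g cw i.
(** On the diagonal the order is 1 and the entry is - cos pi = 1, so simple roots are unit
    vectors. *)
Definition gram : 'M[R]_rank :=
  \matrix_(i, j) - cos (pi / #[gen i * gen j]%g%:R).
Definition simple i : 'cV[R]_rank := \col_j (j == i :> nat)%:R.
Definition scoef i (x : 'cV[R]_rank) : R := ((simple i)^T *m x) 0 0.
Definition nonneg x := forall i, (i < rank)%N -> 0 <= scoef i x.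

Local Notation dot := (gdot gram).
Local Notation sref := (gsref gram).

Lemma gen_S i : (i < rank)%N -> gen i \in S.
Proof. by move=> lti; rewrite -(proj2 cwS) mem_nth. Qed.

Lemma S_gen s : s \in S -> exists2 i, (i < rank)%N & s = gen i.
Proof. by rewrite -(proj2 cwS) => /(nthP 1%g)[i lti <-]; exists i. Qed.

Lemma gen_inj i j : (i < rank)%N -> (j < rank)%N -> gen i = gen j -> i = j.
Proof.
move=> lti ltj /eqP; rewrite nth_uniq //; first by move/eqP.
exact: (proj1 cwS).
Qed.

Lemma gen_order i : (i < rank)%N -> #[gen i]%g = 2%N.
Proof. by case: WS => _ S2 _ /gen_S; apply: S2. Qed.

Lemma genK i : (i < rank)%N -> (gen i * gen i = 1)%g.
Proof. by move=> /gen_order g2; rewrite -expg2 -g2 expg_order. Qed.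

Lemma gen_invg i : (i < rank)%N -> (gen i)^-1%g = gen i.
Proof. by move=> /genK/mulg1_eq. Qed.

Lemma gen_mul_order i j : (i < rank)%N -> (j < rank)%N -> i != j ->
  (1 < #[gen i * gen j]%g)%N.
Proof.
move=> lti ltj neqij; rewrite ltn_neqAle order_gt0 andbT eq_sym order_eq1.
apply: contra neqij => /eqP/mulg1_eq gij; apply/eqP/gen_inj => //.
by rewrite -(gen_invg lti).
Qed.

Lemma gram_sym : gram^T = gram.
Proof.
apply/matrixP => i j; rewrite !mxE; congr (- cos (_ / _%:R)).
by rewrite -orderV invMg !gen_invg.
Qed.

Lemma scoefE i (lti : (i < rank)%N) x : scoef i x = x (Ordinal lti) 0.
Proof.
rewrite /scoef mxE (bigD1 (Ordinal lti)) //= !mxE eqxx mul1r big1 ?addr0 //.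
move=> j neqj; rewrite !mxE; case: eqP => [ej|]; last by rewrite mul0r.
by case/eqP: neqj; apply: val_inj.
Qed.

Lemma scoefD i x y : scoef i (x + y) = scoef i x + scoef i y.
Proof. by rewrite /scoef mulmxDr mxE. Qed.

Lemma scoefZ i a x : scoef i (a *: x) = a * scoef i x.
Proof. by rewrite /scoef -scalemxAr mxE. Qed.

Lemma scoefN i x : scoef i (- x) = - scoef i x.
Proof. by rewrite /scoef mulmxN mxE. Qed.

Lemma scoefB i x y : scoef i (x - y) = scoef i x - scoef i y.
Proof. by rewrite scoefD scoefN. Qed.

Lemma scoef0 i : scoef i 0 = 0.
Proof. by rewrite /scoef mulmx0 mxE. Qed.

Lemma scoef_simple i j : (i < rank)%N -> scoef i (simple j) = (i == j)%:R.
Proof. by move=> lti; rewrite (scoefE lti) mxE. Qed.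

Lemma scoefP x y : (forall i, (i < rank)%N -> scoef i x = scoef i y) -> x = y.
Proof.
move=> exy; apply/colP => -[i lti].
by have := exy i lti; rewrite !(scoefE lti).
Qed.

Lemma scoef_sum (I : Type) (r : seq I) (P : pred I) F i :
  scoef i (\sum_(k <- r | P k) F k) = \sum_(k <- r | P k) scoef i (F k).
Proof. by apply: big_morph => [x y|]; rewrite ?scoefD ?scoef0. Qed.

Lemma simple_sum x : x = \sum_(i < rank) scoef i x *: simple i.
Proof.
apply: scoefP => i lti; rewrite scoef_sum (bigD1 (Ordinal lti)) //=.
rewrite scoefZ scoef_simple // eqxx mulr1 big1 ?addr0 // => j neqj.
rewrite scoefZ scoef_simple //; case: eqP => [ej|]; last by rewrite mulr0.
by case/eqP: neqj; apply: val_inj.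
Qed.

Lemma dot_simple i j : (i < rank)%N -> (j < rank)%N ->
  dot (simple i) (simple j) = - cos (pi / #[gen i * gen j]%g%:R).
Proof.
move=> lti ltj; rewrite /gdot -mulmxA -/(scoef i _) (scoefE lti).
rewrite mxE (bigD1 (Ordinal ltj)) //= !mxE eqxx mulr1 big1 ?addr0 //.
move=> k neqk; rewrite !mxE; case: eqP => [ek|]; last by rewrite mulr0.
by case/eqP: neqk; apply: val_inj.
Qed.

Lemma dot_simple1 i : (i < rank)%N -> dot (simple i) (simple i) = 1.
Proof.
by move=> lti; rewrite dot_simple // genK // order1 divr1 cospi opprK.
Qed.

Lemma dot_simple_le0 i j : (i < rank)%N -> (j < rank)%N -> i != j ->
  dot (simple i) (simple j) <= 0.
Proof.
move=> lti ltj neqij; rewrite dot_simple // oppr_le0.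
have m1 := gen_mul_order lti ltj neqij; set m := #[_]%g in m1 *.
apply: cos_ge0_pihalf; apply/andP; split.
  by rewrite (le_trans (y := 0)) ?oppr_le0 ?divr_ge0 ?ler0n ?pi_ge0.
rewrite ler_pM2l ?pi_gt0 // lef_pV2 ?posrE ?ltr0n ?ler_nat //.
by rewrite (ltn_trans _ m1).
Qed.

Definition sref_mx (b : 'cV[R]_rank) : 'M[R]_rank :=
  1%:M - 2 *: (b *m (b^T *m gram)).

Lemma sref_mxE b x : sref_mx b *m x = sref b x.
Proof.
rewrite /sref_mx mulmxBl mul1mx -scalemxAl -mulmxA [_ *m gram *m x]mx11_scalar.
by rewrite mul_mx_scalar scalerA.
Qed.

Lemma sref_simpleK i x : (i < rank)%N -> sref (simple i) (sref (simple i) x) = x.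
Proof. by move=> lti; rewrite srefK // ?dot_simple1 //; apply: gram_sym. Qed.

Fact sref_mx_unit s : s \in S -> sref_mx (simple (index s cw)) \in unitmx.
Proof.
rewrite -(proj2 cwS) -index_mem => lti.
suff: sref_mx (simple (index s cw)) *m sref_mx (simple (index s cw)) = 1%:M.
  by case/mulmx1_unit.
apply: eq_mulmx_cV => x.
by rewrite -mulmxA !sref_mxE sref_simpleK ?mul1mx.
Qed.

Definition simple_gl (s : W) : gl R rank :=
  insubd (gl_one R rank) (sref_mx (simple (index s cw))).

Lemma geometric_rep : exists rho : W -> 'M[R]_rank,
  [/\ rho 1%g = 1%:M, forall x y, rho (x * y)%g = rho x *m rho y &
      forall i x, (i < rank)%N -> rho (gen i) *m x = sref (simple i) x].
Proof.
have gl_gen i : (i < rank)%N -> val (simple_gl (gen i)) = sref_mx (simple i).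
  move=> lti; rewrite val_insubd.
  by rewrite sref_mx_unit ?gen_S // index_uniq //; case: cwS.
case: WS => _ _ /(_ (gl R rank) simple_gl)[].
  move=> s t /S_gen[i lti ->] /S_gen[j ltj ->].
  apply: val_inj; apply: eq_mulmx_cV => x; rewrite val_glX mul1mx.
  rewrite (eq_iter (_ : _ =1 fun y => sref (simple i) (sref (simple j) y))).
    2: by move=> y; rewrite !gl_gen // !sref_mxE.
  have [<-|neqij] := eqVneq i j; first by rewrite genK // order1 /= sref_simpleK.
  apply: sref_dihedral_order; rewrite ?dot_simple1 ?dot_simple //.
    exact: gram_sym.
  exact: gen_mul_order.
move=> phi phiE; exists (fun w => val (phi w)); split=> [|x y|i x lti].
- suff -> : phi 1%g = 1%g by [].
  by apply: (mulgI (phi 1%g)); rewrite -gmulfM !mulg1.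
- by rewrite gmulfM.
by rewrite phiE ?gen_S // gl_gen // sref_mxE.
Qed.

End SimpleReflections.

(** * Length and positivity of roots *)

Section WordLength.
Local Open Scope group_scope.
Variables (W : finGroupType) (S : {set W}).
Hypothesis WS : coxeter_system S.

Definition has_word (w : W) k :=
  [exists t : k.-tuple W, all (mem S) t && (\prod_(s <- t) s == w)].

Lemma has_wordP w k :
  reflect (exists u, [/\ {subset u <= S}, \prod_(s <- u) s = w & size u = k])
    (has_word w k).
Proof.
apply: (iffP existsP) => [[t /andP[/allP tS /eqP <-]]|[u [uS uw uk]]].
  by exists (val t); rewrite size_tuple.
exists (tcast uk (in_tuple u)); rewrite val_tcast /= uw eqxx andbT.
exact/allP.
Qed.

Lemma word_exists w : exists k, has_word w k.
Proof.
have: w \in <<S>> by case: WS => -> _ _; rewrite inE.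
case/gen_prodgP=> k [c cS ->]; exists k; apply/has_wordP.
exists [seq c i | i <- enum 'I_k]; split.
- by move=> s /mapP[i _ ->].
- by rewrite big_map enumT [index_enum _]unlock.
by rewrite size_map size_enum_ord.
Qed.

Definition len w := ex_minn (word_exists w).

Lemma len_word w :
  exists u, [/\ {subset u <= S}, \prod_(s <- u) s = w & size u = len w].
Proof. by rewrite /len; case: ex_minnP => k /has_wordP. Qed.

Lemma len_prod u : {subset u <= S} -> len (\prod_(s <- u) s) <= size u.
Proof.
move=> uS; rewrite /len; case: ex_minnP => k _; apply.
by apply/has_wordP; exists u.
Qed.

Lemma reduced_wordP w u :
  reduced_word S w u <-> [/\ {subset u <= S}, \prod_(s <- u) s = w & size u = len w].
Proof.
split=> [[uS uw umin]|[uS uw uk]]; split=> //; last first.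
  by move=> v vS vw; rewrite uk -vw len_prod.
apply/eqP; rewrite eqn_leq -{2}uw len_prod // andbT.
by have [v [vS vw <-]] := len_word w; apply: umin.
Qed.

Lemma len1 : len 1 = 0%N.
Proof. by apply/eqP; have := @len_prod [::]; rewrite big_nil leqn0; apply. Qed.

Lemma lenM x y : len (x * y) <= len x + len y.
Proof.
have [u [uS <- <-]] := len_word x; have [v [vS <- <-]] := len_word y.
rewrite -big_cat -size_cat; apply: len_prod => s; rewrite mem_cat.
by case/orP; [apply: uS | apply: vS].
Qed.

Lemma S_invol s : s \in S -> s * s = 1.
Proof. by case: WS => _ S2 _ /S2 s2; rewrite -expg2 -s2 expg_order. Qed.

Lemma prod_rev_S u : {subset u <= S} ->
  \prod_(s <- rev u) s = (\prod_(s <- u) s)^-1.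
Proof.
elim: u => [|s u IH] uS; first by rewrite !big_nil invg1.
rewrite rev_cons -cats1 big_cat /= !big_cons big_nil mulg1 invMg IH.
  by congr (_ * _); apply/esym/mulg1_eq/S_invol/uS/mem_head.
by move=> t tu; apply: uS; rewrite inE tu orbT.
Qed.

Lemma lenV x : len x^-1 = len x.
Proof.
suff le_lenV y : len y^-1 <= len y.
  by apply/eqP; rewrite eqn_leq le_lenV -{1}[x]invgK le_lenV.
have [u [uS <- <-]] := len_word y; rewrite -(size_rev u).
rewrite -prod_rev_S //.
by apply: len_prod => s; rewrite mem_rev; apply: uS.
Qed.

Lemma len_S s : s \in S -> len s <= 1.
Proof.
by move=> sS; have := @len_prod [:: s]; rewrite big_seq1; apply=> t; rewrite inE => /eqP->.
Qed.

Lemma lenMS w s : s \in S -> len (w * s) <= (len w).+1.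
Proof. by move=> /len_S s1; rewrite (leq_trans (lenM _ _)) // -addn1 leq_add2l. Qed.

Lemma len_le_MS w s : s \in S -> len w <= (len (w * s)).+1.
Proof.
by move=> sS; rewrite -{1}(mulg1 w) -(S_invol sS) mulgA lenMS.
Qed.

Lemma len_last w : w != 1 -> exists2 s, s \in S & len (w * s) < len w.
Proof.
move=> wN1; have [u [uS uw uk]] := len_word w.
case/lastP: u => [|u s] in uS uw uk; first by rewrite -uw big_nil eqxx in wN1.
have sS : s \in S by apply: uS; rewrite mem_rcons mem_head.
exists s; rewrite // -uk -uw -cats1 big_cat big_seq1 -mulgA S_invol // mulg1.
rewrite cats1 size_rcons ltnS; apply: len_prod => t tu; apply: uS.
by rewrite mem_rcons inE tu orbT.
Qed.

Fixpoint alternating (k : nat) (s t : W) : W :=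
  if k is k'.+1 then alternating k' t s * t else 1.

Lemma alternatingS k s t :
  alternating k.+1 s t = (if odd k then s else t) * alternating k s t.
Proof.
elim: k s t => [|k IH] s t; first by rewrite /= mulg1 mul1g.
rewrite -[LHS]/(alternating k.+1 t s * t) IH -mulgA /=.
by case: (odd k).
Qed.

Lemma len_alternating k s t : s \in S -> t \in S -> len (alternating k s t) <= k.
Proof.
elim: k s t => [|k IH] s t sS tS; first by rewrite len1.
by rewrite /= (leq_trans (lenMS _ _)) // ltnS IH.
Qed.

Lemma alternating_double k s t : alternating k.*2 s t = (s * t) ^+ k.
Proof. by elim: k => // k IH; rewrite doubleS /= IH expgSr mulgA. Qed.

Lemma alternating_order s t : s \in S -> t \in S ->
  alternating #[s * t] s t = alternating #[s * t] t s.
Proof.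
move=> sS tS; have e := expg_order (s * t); move: e; set m := #[_] => e.
have ts : t * s = (s * t)^-1.
  by rewrite invMg; congr (_ * _); apply/esym/mulg1_eq/S_invol.
have [m_odd | m_even] := boolP (odd m).
  rewrite -(odd_double_half m) m_odd add1n !alternatingS odd_double.
  rewrite !alternating_double ts expVgn.
  apply: (mulgI s); rewrite !mulgA S_invol // mul1g -expgS.
  apply/(mulIg ((s * t) ^+ m./2)); rewrite mulVg -expgD -e; congr (_ ^+ _); lia.
rewrite -(odd_double_half m).
rewrite (negPf m_even) add0n !alternating_double ts expVgn.
apply/(mulIg ((s * t) ^+ m./2)); rewrite mulVg -expgD -e; congr (_ ^+ _); lia.
Qed.

End WordLength.

(** * The numerical data of a reflection order *)

Section EulerRoots.
Local Open Scope ring_scope.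

(** The geometric input of the combinatorial half, with [root r] a chosen root of r. [er_sign] is
    the property of the order of R(c), and [er_word] the criterion for a product to be c. In
    [er_conj] the sum of the two values of E stands for 2 B; the sign stays open because a
    reflection may send a chosen root to the opposite of a chosen root. *)
Record euler_roots (R : realFieldType) (W : finGroupType) (A : {set W}) (c : W)
    (Rc : seq W) (n : nat) (E : 'cV[R]_n -> 'cV[R]_n -> R)
    (root : W -> 'cV[R]_n) : Prop := EulerRoots {
  erDl : forall x y z, E (y + z) x = E y x + E z x;
  erZl : forall a x y, E (a *: x) y = a * E x y;
  erDr : forall x y z, E x (y + z) = E x y + E x z;
  erZr : forall a x y, E x (a *: y) = a * E x y;
  er_uniq : uniq Rc;
  er_mem : Rc =i A;
  er_invol : {in Rc, forall r, (r * r = 1)%g};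
  er1 : {in Rc, forall r, E (root r) (root r) = 1};
  er_sign : {in Rc &, forall r t, (index r Rc < index t Rc)%N ->
    E (root r) (root t) <= 0 /\ 0 <= E (root t) (root r)};
  er_conj : {in Rc &, forall r t, (r * t * r)%g \in Rc /\
    let u := root t - (E (root r) (root t) + E (root t) (root r)) *: root r in
    root (r * t * r)%g = u \/ root (r * t * r)%g = - u};
  er_word : forall rs, {subset rs <= Rc} ->
    (reduced_word A c rs <-> size rs = n /\
      forall i j, (i < j < n)%N ->
        E (root (nth 1%g rs j)) (root (nth 1%g rs i)) = 0);
  er_span : forall rs u, {subset rs <= Rc} -> reduced_word A c rs ->
    exists f : nat -> R, u = \sum_(i < n) f i *: root (nth 1%g rs i)
}.

End EulerRoots.

Section GeometricAction.
Local Open Scope ring_scope.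
Variables (R : realType) (W : finGroupType) (S : {set W}) (cw : seq W).
Hypotheses (WS : coxeter_system S) (cwS : coxeter_word S cw).

Local Notation n := (rank cw).
Local Notation g := (gen cw).
Local Notation alpha := (simple R cw).
Local Notation dot := (gdot (gram R cw)).
Local Notation sref := (gsref (gram R cw)).
Local Notation len := (len WS).

Let a1 := dot_simple1 R WS cwS.
Let Gs := gram_sym R WS cwS.
Let gK := genK WS cwS.
Let gV := gen_invg WS cwS.

Variable rho : W -> 'M[R]_n.
Hypotheses (rho1 : rho 1%g = 1%:M)
  (rhoM : forall x y, rho (x * y)%g = rho x *m rho y)
  (rho_gen : forall i x, (i < n)%N -> rho (g i) *m x = sref (alpha i) x).

Definition ract w (x : 'cV[R]_n) := rho w *m x.

Implicit Types (v w : W) (x y : 'cV[R]_n) (i j : nat).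

Lemma ract1 x : ract 1%g x = x. Proof. by rewrite /ract rho1 mul1mx. Qed.
Lemma ractM v w x : ract (v * w)%g x = ract v (ract w x).
Proof. by rewrite /ract rhoM mulmxA. Qed.
Lemma ractK w : cancel (ract w) (ract w^-1%g).
Proof. by move=> x; rewrite -ractM mulVg ract1. Qed.
Lemma ractVK w : cancel (ract w^-1%g) (ract w).
Proof. by move=> x; rewrite -ractM mulgV ract1. Qed.
Lemma ract_gen i x : (i < n)%N -> ract (g i) x = sref (alpha i) x.
Proof. exact: rho_gen. Qed.
Lemma ractD w x y : ract w (x + y) = ract w x + ract w y.
Proof. exact: mulmxDr. Qed.
Lemma ractZ w a x : ract w (a *: x) = a *: ract w x.
Proof. by rewrite /ract scalemxAr. Qed.
Lemma ractN w x : ract w (- x) = - ract w x.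
Proof. exact: mulmxN. Qed.
Lemma ractB w x y : ract w (x - y) = ract w x - ract w y.
Proof. exact: mulmxBr. Qed.
Lemma ract_sum w (I : Type) (r : seq I) (P : pred I) F :
  ract w (\sum_(k <- r | P k) F k) = \sum_(k <- r | P k) ract w (F k).
Proof. exact: mulmx_sumr. Qed.
Lemma ract0 w : ract w 0 = 0. Proof. exact: mulmx0. Qed.

Lemma ract_gen_simple i : (i < n)%N -> ract (g i) (alpha i) = - alpha i.
Proof.
move=> lti; rewrite ract_gen // /gsref a1 // mulr1.
by rewrite -[2]/(1 + 1) scalerDl scale1r opprD addrA subrr add0r.
Qed.

Lemma nonnegD x y : nonneg x -> nonneg y -> nonneg (x + y).
Proof. by move=> x0 y0 i lti; rewrite scoefD addr_ge0 ?x0 ?y0. Qed.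

Lemma nonnegZ a x : 0 <= a -> nonneg x -> nonneg (a *: x).
Proof. by move=> a0 x0 i lti; rewrite scoefZ mulr_ge0 ?x0. Qed.

Lemma nonneg_simple i : nonneg (alpha i).
Proof. by move=> j ltj; rewrite scoef_simple // ler0n. Qed.

Lemma nonneg_antisym x : nonneg x -> nonneg (- x) -> x = 0.
Proof.
move=> x0 Nx0; apply: scoefP => i lti; rewrite scoef0.
by apply/le_anti; rewrite x0 // andbT -oppr_ge0 -scoefN Nx0.
Qed.

Lemma ract_alternating k i j : (i < n)%N -> (j < n)%N -> i != j ->
  ract (alternating k (g i) (g j)) (alpha i) =
    let m := #[g i * g j]%g in
    if odd k then dihedral_root m k (alpha j) (alpha i)
    else dihedral_root m k (alpha i) (alpha j).
Proof.
move=> lti ltj neqij; have m1 := gen_mul_order WS cwS lti ltj neqij.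
elim: k => [|k IH] /=; first by rewrite ract1 dihedral_root0.
rewrite -[(_ * _)%g]/(alternating k.+1 _ _) alternatingS ractM {}IH /=.
case: (odd k) => /=; rewrite ract_gen // sref_dihedral_root ?a1 //.
  exact: dot_simple.
by rewrite dotC // dot_simple.
Qed.

(* Factor w = v u with lengths adding, where u is the longest possible suffix
   alternating between g i and a right descent of w: then v is shorter and has
   neither letter as a right descent, and u acts by the dihedral formulas. *)
Lemma ract_simple_nonneg w i : (i < n)%N -> (len w <= len (w * g i)%g)%N ->
  nonneg (ract w (alpha i)).
Proof.
have [k] := ubnP (len w); elim: k w i => // k IH w i /ltnSE lt_w_k lti le_w.
have [->|wN1] := eqVneq w 1%g; first by rewrite ract1; apply: nonneg_simple.
have [s /(S_gen cwS)[j ltj ->] lt_wj] := len_last WS wN1.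
have neqij : i != j by apply: contraTneq lt_wj => <-; rewrite -leqNgt.
have gi_S := gen_S cwS lti; have gj_S := gen_S cwS ltj.
set m := #[g i * g j]%g; have m1 := gen_mul_order WS cwS lti ltj neqij.
pose alt l := alternating l (g i) (g j).
pose reduced l := (len (w * (alt l)^-1)%g + l == len w)%N.
have len_alt l : (len w <= len (w * (alt l)^-1)%g + l)%N.
  rewrite -{1}[w](mulgKV (alt l)) (leq_trans (lenM _ _ _)) // leq_add2l.
  exact: len_alternating.
have altV l : (alt l.+1)^-1%g = ((alt l)^-1 * (if odd l then g i else g j))%g.
  by rewrite /alt alternatingS invMg; case: (odd l); rewrite gV.
have reducedW l : reduced l.+1 -> reduced l.
  rewrite /reduced altV mulgA => /eqP e; rewrite eqn_leq len_alt andbT -e.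
  rewrite -addSnnS leq_add2r; case: ifP => _; exact: len_le_MS.
have reduced_le l l' : (l <= l')%N -> reduced l' -> reduced l.
  move=> /subnK <-; elim: (l' - l)%N => // d IHd; rewrite addSn.
  by move/reducedW.
have red0 : reduced 0 by rewrite /reduced /alt /= invg1 mulg1 addn0.
have red1 : reduced 1.
  rewrite /reduced altV /alt /= invg1 mul1g addn1 eqn_leq lt_wj /=.
  exact: len_le_MS.
have red_bound l : reduced l -> (l <= len w)%N by move/eqP <-; apply: leq_addl.
case: (ex_maxnP (ex_intro _ 1%N red1) red_bound) => l red_l max_l.
have l_gt0 : (0 < l)%N := max_l _ red1.
(* By the braid relation, an alternating suffix of length m could be rewritten so as to end in
   [g i], against [le_w]. *)
have lt_l_m : (l < m)%N.
  rewrite ltnNge; apply: contraL le_w => /reduced_le/(_ red_l).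
  rewrite -ltnNge /reduced /alt (alternating_order WS) // -/m => /eqP <-.
  have -> : m = m.-1.+1 by rewrite prednK // ltnW.
  rewrite addnS ltnS /= -{1}[w](mulgKV (alternating m.-1.+1 (g j) (g i))) /=.
  rewrite -!mulgA gK // mulg1 mulgA.
  by rewrite (leq_trans (lenM _ _ _)) // leq_add2l len_alternating.
pose v := (w * (alt l)^-1)%g.
have lt_vk : (len v < k)%N.
  apply: leq_trans lt_w_k; move/eqP: red_l => <-.
  by rewrite -[X in (X < _)%N]addn0 ltn_add2l.
have v_next : (len v <= len (v * (if odd l then g i else g j))%g)%N.
  rewrite leqNgt; apply/negP => lt_v; suff /max_l : reduced l.+1 by rewrite ltnn.
  rewrite /reduced eqn_leq len_alt andbT altV mulgA -/v addnS -addSn.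
  by move/eqP: red_l => <-; rewrite leq_add2r.
have v_prev : (len v <= len (v * (if odd l then g j else g i))%g)%N.
  rewrite /v; case: l l_gt0 red_l {max_l lt_l_m v lt_vk v_next} => // l _ red_l.
  rewrite -(leq_add2r l.+1) (eqP red_l) (leq_trans (len_alt l)) //.
  rewrite addnS -addSn leq_add2r altV /= if_neg !mulgA.
  case: (odd l); rewrite -!mulgA gK // mulg1; exact: leqnSn.
have vi : nonneg (ract v (alpha i)).
  by apply: IH => //; case: (odd l) v_next v_prev.
have vj : nonneg (ract v (alpha j)).
  by apply: IH => //; case: (odd l) v_next v_prev.
rewrite -[w](mulgKV (alt l)) -/v ractM ract_alternating //= -/m.
have s0 : 0 < sin (pi / m%:R) :> R := sin_theta_gt0 R m1.
have c0 h : (h <= m)%N -> 0 <= sin (h%:R * (pi / m%:R)) / sin (pi / m%:R) :> R.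
  by move=> lehm; apply: divr_ge0 (ltW s0); apply: sin_mul_theta_ge0.
by case: (odd l); rewrite /dihedral_root ractD !ractZ; apply: nonnegD;
  apply: nonnegZ => //; apply: c0 => //; apply: ltnW.
Qed.

Lemma ract_simple_nonpos w i : (i < n)%N -> (len (w * g i)%g <= len w)%N ->
  nonneg (- ract w (alpha i)).
Proof.
move=> lti le_w; rewrite -ractN -ract_gen_simple // -ractM.
by apply: ract_simple_nonneg => //; rewrite -mulgA gK // mulg1.
Qed.

Lemma ract_dot w x y : dot (ract w x) (ract w y) = dot x y.
Proof.
have [u [uS <- _]] := len_word WS w.
elim: u uS x y => [|s u IH] uS x y; first by rewrite big_nil !ract1.
rewrite big_cons !ractM.
have /(S_gen cwS)[i lti ->] : s \in S by apply: uS; apply: mem_head.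
rewrite !ract_gen // sref_dot ?a1 //.
by apply: IH => t tu; apply: uS; rewrite inE tu orbT.
Qed.

Lemma root1 w i : (i < n)%N -> dot (ract w (alpha i)) (ract w (alpha i)) = 1.
Proof. by move=> lti; rewrite ract_dot a1. Qed.

Lemma root_neq0 w i : (i < n)%N -> ract w (alpha i) <> 0.
Proof.
by move=> lti e; have := root1 w lti; rewrite e dot0r => /eqP; rewrite eq_sym oner_eq0.
Qed.

Lemma nonneg_len w i : (i < n)%N -> nonneg (ract w (alpha i)) ->
  (len w < len (w * g i)%g)%N.
Proof.
move=> lti w0; rewrite ltnNge; apply/negP => /(ract_simple_nonpos lti).
by move/(nonneg_antisym w0)/(root_neq0 lti).
Qed.

Lemma root_cases w i : (i < n)%N ->
  nonneg (ract w (alpha i)) \/ nonneg (- ract w (alpha i)).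
Proof.
move=> lti; have [le_w|lt_w] := leqP (len w) (len (w * g i)%g).
  by left; apply: ract_simple_nonneg.
by right; apply: ract_simple_nonpos; last exact: ltnW.
Qed.

(** Any w other than 1 has a right descent, and a descent sends its simple root to a negative one.
    Faithfulness of the representation follows. *)
Lemma ract_nonneg_eq1 w : (forall i, (i < n)%N -> nonneg (ract w (alpha i))) ->
  w = 1%g.
Proof.
move=> w0; apply/eqP; apply: contraT => /(len_last WS)[s].
case/(S_gen cwS)=> i lti -> lt_w; have := nonneg_len lti (w0 i lti).
by rewrite ltnNge (ltnW lt_w).
Qed.

Lemma ract_inj v w : (forall x, ract v x = ract w x) -> v = w.
Proof.
move=> evw; apply: (mulIg w^-1%g); rewrite mulgV.
apply: ract_nonneg_eq1 => i lti; rewrite ractM evw ractVK.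
exact: nonneg_simple.
Qed.

(* Finiteness of W enters here: x is orthogonal to the simple roots for the
   average D of the standard scalar product, hence D x x = 0. *)
Lemma dot_simple_eq0 x : (forall i, (i < n)%N -> dot (alpha i) x = 0) -> x = 0.
Proof.
move=> x_orth; pose D y z := \sum_(w : W) ((ract w y)^T *m ract w z) 0 0.
have D_act v y z : D (ract v y) (ract v z) = D y z.
  rewrite [RHS](reindex_inj (mulIg v)); apply: eq_bigr => w _.
  by rewrite !ractM.
(* The i-th simple reflection fixes x and negates [alpha i], so this value of D is its own
   opposite. *)
have Dx i : (i < n)%N -> D (alpha i) x = 0.
  move=> lti; have := D_act (g i) (alpha i) x; rewrite ract_gen_simple //.
  rewrite ract_gen // /gsref x_orth // mulr0 scale0r subr0 => e.
  suff: D (- alpha i) x = - D (alpha i) x by rewrite e; lra.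
  rewrite /D -sumrN; apply: eq_bigr => w _.
  by rewrite ractN linearN mulNmx mxE.
have D0 : D x x = 0.
  rewrite {1}[x]simple_sum; apply: (@big_ind _ (fun y => D y x = 0)) => [|y z|i _].
  - by rewrite /D big1 // => w _; rewrite ract0 trmx0 mul0mx mxE.
  - move=> Dy Dz; rewrite -[RHS](addr0 0) -{1}Dy -Dz /D -big_split /=.
    by apply: eq_bigr => w _; rewrite ractD linearD mulmxDl mxE.
  rewrite -(mulr0 (scoef i x)) -(Dx i) // /D mulr_sumr; apply: eq_bigr => w _.
  by rewrite ractZ linearZ -scalemxAl mxE.
have sq_ge0 w : 0 <= ((ract w x)^T *m ract w x) 0 0.
  by rewrite mxE sumr_ge0 // => i _; rewrite mxE -expr2 sqr_ge0.
have := @psumr_eq0P _ _ predT _ (fun w _ => sq_ge0 w) D0 1%g isT.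
rewrite ract1 mxE => x0; apply/colP => i; rewrite [RHS]mxE.
have := @psumr_eq0P _ _ predT _ _ x0 i isT => /(_ _)/eqP.
rewrite mxE mulf_eq0 orbb => /(_ _)/eqP; apply=> j _.
by rewrite mxE -expr2 sqr_ge0.
Qed.

(** * Powers of a Coxeter element and the sorting word of the longest element *)

Local Notation word_prod l := (\prod_(i <- l) g i)%g.

Lemma scoef_sref i j x : (i < n)%N -> i != j ->
  scoef i (sref (alpha j) x) = scoef i x.
Proof.
move=> lti neqij; rewrite /gsref scoefB scoefZ scoef_simple // (negPf neqij).
by rewrite mulr0 subr0.
Qed.

Lemma scoef_sref_same i x : (i < n)%N ->
  scoef i (sref (alpha i) x) = scoef i x - 2 * dot (alpha i) x.
Proof.
by move=> lti; rewrite /gsref scoefB scoefZ scoef_simple // eqxx mulr1.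
Qed.

Lemma scoef_word i l x : (i < n)%N -> {in l, forall j, (j < n)%N} ->
  i \notin l -> scoef i (ract (word_prod l) x) = scoef i x.
Proof.
move=> lti; elim: l => [|j l IH] ltl; first by rewrite big_nil ract1.
rewrite inE negb_or => /andP[neqij il].
have ltj : (j < n)%N by apply: ltl; apply: mem_head.
rewrite big_cons ractM ract_gen // scoef_sref // IH // => k kl.
by apply: ltl; rewrite inE kl orbT.
Qed.

Lemma ract_word_fix l x : {in l, forall j, (j < n)%N} ->
  {in l, forall j, dot (alpha j) x = 0} -> ract (word_prod l) x = x.
Proof.
elim: l => [|j l IH] ltl xl; first by rewrite big_nil ract1.
rewrite big_cons ractM IH => [|k kl|k kl].
- by rewrite ract_gen ?ltl ?mem_head // /gsref xl ?mem_head // mulr0 scale0r subr0.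
- by apply: ltl; rewrite inE kl orbT.
by apply: xl; rewrite inE kl orbT.
Qed.

(** The coordinate along [alpha i] is changed by the letter i alone, which occurs once in the word;
    comparing this coordinate peels off the first letter. *)
Lemma ract_word_eq l x : uniq l -> {in l, forall j, (j < n)%N} ->
  ract (word_prod l) x = x -> {in l, forall j, dot (alpha j) x = 0}.
Proof.
elim: l x => [|i l IH] x //= /andP[il ul] ltl.
have lti : (i < n)%N by apply: ltl; apply: mem_head.
have ltl' : {in l, forall j, (j < n)%N}.
  by move=> k kl; apply: ltl; rewrite inE kl orbT.
rewrite big_cons ractM ract_gen //; set y := ract _ x => yx.
have xi : dot (alpha i) x = 0.
  have : scoef i (sref (alpha i) x) = scoef i x.
    by rewrite -{1}yx (sref_simpleK WS cwS) // /y scoef_word.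
  by rewrite scoef_sref_same //; lra.
have yx' : y = x.
  have := sref_simpleK WS cwS y lti; rewrite yx => <-.
  by rewrite /gsref xi mulr0 scale0r subr0.
by move=> j; rewrite inE => /orP[/eqP->//|]; apply: IH.
Qed.

Definition cox : W := \prod_(s <- cw) s.

Lemma cox_iota : cox = word_prod (iota 0 n).
Proof.
by rewrite /cox -{1}[cw](mkseq_nth 1%g) /mkseq big_map.
Qed.

Lemma cox_fix x : ract cox x = x -> x = 0.
Proof.
rewrite cox_iota => cx; apply: dot_simple_eq0 => i lti.
by apply: (ract_word_eq (iota_uniq 0 n) _ cx) => [j|]; rewrite mem_iota.
Qed.

Lemma cox_dot x y : dot (rho cox *m x) (rho cox *m y) = dot x y.
Proof. exact: ract_dot. Qed.

Local Notation E := (euler (gram R cw) (rho cox)).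

(** Fundamental weights, scaled so that the s-th simple reflection subtracts exactly [alpha s]. *)
Lemma simple_dual s : exists z, forall i, (i < n)%N ->
  2 * dot (alpha i) z = (i == s)%:R.
Proof.
pose bs := [seq alpha i | i <- iota 0 n].
have sz_bs : size bs = n by rewrite size_map size_iota.
have [|z zE] := exists_dual Gs (fun i => (i == s)%:R / 2) sz_bs.
  move=> x xbs; apply: dot_simple_eq0 => i lti; apply: xbs.
  by apply: map_f; rewrite mem_iota.
exists z => i lti; have := zE i lti; rewrite (nth_map 0%N) ?size_iota //.
by rewrite nth_iota // add0n => ->; rewrite mulrC divfK ?pnatr_eq0.
Qed.

Lemma sref_dual s z : (s < n)%N ->
  (forall i, (i < n)%N -> 2 * dot (alpha i) z = (i == s)%:R) ->
  ract (g s) z = z - alpha s.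
Proof.
by move=> lts zE; rewrite ract_gen // /gsref zE // eqxx scale1r.
Qed.

Lemma dual_orth s z :
  (forall i, (i < n)%N -> 2 * dot (alpha i) z = (i == s)%:R) ->
  forall i, (i < n)%N -> i != s -> dot (alpha i) z = 0.
Proof.
move=> zE i lti neqis; have := zE i lti; rewrite (negPf neqis) /=; lra.
Qed.

Section CoxeterPowers.
Hypothesis n_gt0 : (0 < n)%N.

Definition letters p k := [seq (i %% n)%N | i <- iota p k].
Definition cpre p : W := word_prod (letters 0 p).
(** The root attached to position p of c c c ...; as this word is not reduced, the root may be
    negative. *)
Definition beta p := ract (cpre p) (alpha (p %% n)%N).

Lemma ltmod p : (p %% n < n)%N. Proof. exact: ltn_pmod. Qed.

Lemma letters_lt p k : {in letters p k, forall j, (j < n)%N}.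
Proof. by move=> j /mapP[i _ ->]; apply: ltmod. Qed.

Lemma lettersD p k l : letters p (k + l) = letters p k ++ letters (p + k) l.
Proof. by rewrite /letters iotaD map_cat. Qed.

Lemma cpreD p k : cpre (p + k) = (cpre p * word_prod (letters p k))%g.
Proof. by rewrite /cpre lettersD big_cat. Qed.

Lemma cpreS p : cpre p.+1 = (cpre p * g (p %% n))%g.
Proof. by rewrite -addn1 cpreD /= big_seq1. Qed.

Lemma letters_small k : (k <= n)%N -> letters 0 k = iota 0 k.
Proof.
move=> lekn; rewrite /letters -[RHS]map_id; apply/eq_in_map => i.
by rewrite mem_iota add0n => /andP[_ ltik]; rewrite modn_small // (leq_trans ltik).
Qed.

Lemma letters_shift p k : letters (n + p) k = letters p k.
Proof.
rewrite /letters iotaDl -map_comp; apply: eq_map => i /=.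
by rewrite modnDl.
Qed.

Lemma cpre_n : cpre n = cox.
Proof. by rewrite /cpre letters_small // cox_iota. Qed.

Lemma cpre_shift p : cpre (n + p) = (cox * cpre p)%g.
Proof. by rewrite cpreD cpre_n -[n]addn0 letters_shift. Qed.

Lemma beta_shift p : beta (n + p) = ract cox (beta p).
Proof. by rewrite /beta cpre_shift ractM modnDl. Qed.

Lemma letters_notin p k : (k < n)%N -> (p %% n)%N \notin letters p.+1 k.
Proof.
move=> ltkn; apply/mapP => -[i]; rewrite mem_iota => /andP[ltpi ltik] /eqP.
rewrite eq_sym eqn_mod_dvd ?(ltnW ltpi) // => /dvdn_leq.
by rewrite subn_gt0 ltpi => /(_ isT); lia.
Qed.

(** The n letters from position p on are s and then every other letter once; the others fix the
    weight z dual to s. Hence moving z by [cpre p] gives the preimage of [beta p] under 1 - c. *)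
Lemma euler_cpre_simple p i : (i < n)%N ->
  E (ract (cpre p) (alpha i)) (beta p) = (i == p %% n)%N%:R.
Proof.
move=> lti; set s := (p %% n)%N; have [z zE] := simple_dual s.
have z0 := dual_orth zE.
have -> : beta p = ract (cpre p) z - rho cox *m ract (cpre p) z.
  rewrite -[rho cox *m _]/(ract cox _) -ractM -cpre_shift addnC cpreD ractM.
  have -> : letters p n = s :: letters p.+1 n.-1 by rewrite -{1}(prednK n_gt0).
  rewrite big_cons ractM (ract_word_fix (@letters_lt p.+1 n.-1)) => [|j jl].
    by rewrite (sref_dual _ zE) ?ltmod // ractB opprB addrC subrK.
  apply: z0; first exact: letters_lt jl.
  by apply: contraTneq jl => ->; apply: letters_notin; rewrite prednK.
by rewrite (eulerE _ cox_fix) ract_dot zE.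
Qed.

Lemma euler_cpre p x : E (ract (cpre p) x) (beta p) = scoef (p %% n)%N x.
Proof.
rewrite {1}[x]simple_sum ract_sum.
transitivity (\sum_(i < n) scoef i x * E (ract (cpre p) (alpha i)) (beta p)).
  apply: (big_ind2 (fun y a => E y (beta p) = a)) => [|y a z b <- <-|i _].
  - by rewrite /euler (dot0l Gs) mulr0.
  - by rewrite (eulerDl Gs).
  by rewrite ractZ (eulerZl Gs).
rewrite (bigD1 (Ordinal (ltmod p))) //= euler_cpre_simple ?ltmod // eqxx mulr1.
rewrite big1 ?addr0 // => i neqi; rewrite euler_cpre_simple //.
by case: eqP => [ei|]; rewrite ?mulr0 //; case/eqP: neqi; apply: val_inj.
Qed.

(** In the first turn the letters before j fix the dual vector z as well, so z itself is the
    preimage of [beta j], and the coordinate is taken in the unmoved basis. *)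
Lemma euler_beta_small j x : (j < n)%N -> E x (beta j) = scoef j x.
Proof.
move=> ltj; have [z zE] := simple_dual j; have z0 := dual_orth zE.
have ltl k l : (k + l <= n)%N -> {in iota k l, forall i, (i < n)%N}.
  by move=> le_kl i; rewrite mem_iota => /andP[_ /leq_trans]; apply.
have -> : beta j = z - rho cox *m z.
  rewrite -[rho cox *m _]/(ract cox _) cox_iota.
  have -> : iota 0 n = iota 0 j ++ j :: iota j.+1 (n - j.+1).
    have e : n = (j + (n - j.+1).+1)%N by lia.
    by rewrite {1}e iotaD.
  rewrite big_cat big_cons /= !ractM.
  rewrite (@ract_word_fix (iota j.+1 _)); first last.
  - by move=> i; rewrite mem_iota => /andP[ltji lti]; apply: z0; lia.
  - by apply: ltl; lia.
  rewrite (sref_dual ltj zE) ractB (@ract_word_fix (iota 0 j) z); first last.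
  - by move=> i; rewrite mem_iota => /andP[_ lti]; apply: z0; lia.
  - by apply: ltl; lia.
  by rewrite opprB addrC subrK /beta /cpre letters_small ?modn_small // ltnW.
rewrite (eulerE _ cox_fix) [x in LHS]simple_sum.
have -> : dot (\sum_(i < n) scoef i x *: alpha i) z =
    \sum_(i < n) scoef i x * dot (alpha i) z.
  apply: (big_ind2 (fun y a => dot y z = a)) => [|y a y' b <- <-|i _].
  - by rewrite (dot0l Gs).
  - by rewrite (dotDl Gs).
  by rewrite (dotZl Gs).
rewrite mulr_sumr (bigD1 (Ordinal ltj)) //= mulrCA zE // eqxx mulr1.
rewrite big1 ?addr0 // => i neqi; rewrite mulrCA zE //.
by case: eqP => [ei|]; rewrite ?mulr0 //; case/eqP: neqi; apply: val_inj.
Qed.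

(** The reflection changes the j-th coordinate alone, so all other coordinates vanish; the unit
    length then leaves only [alpha j]. *)
Lemma nonneg_sref_eq w i j : (i < n)%N -> (j < n)%N ->
  nonneg (ract w (alpha i)) -> nonneg (- ract (g j) (ract w (alpha i))) ->
  ract w (alpha i) = alpha j.
Proof.
move=> lti ltj; set y := ract w _ => y0 gy0.
have yk k : (k < n)%N -> k != j -> scoef k y = 0.
  move=> ltk neqkj; apply/le_anti; rewrite y0 // andbT -oppr_ge0.
  by have := gy0 k ltk; rewrite scoefN ract_gen // scoef_sref.
have yE : y = scoef j y *: alpha j.
  apply: scoefP => k ltk; rewrite scoefZ scoef_simple //.
  by case: eqP => [->|/eqP neq]; rewrite ?mulr1 // yk ?mulr0.
have := root1 w lti; rewrite -/y yE (dotZl Gs) dotZr a1 // mulr1 => /eqP.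
rewrite -expr2 sqrf_eq1 => /orP[/eqP->|/eqP e]; first by rewrite scale1r.
by have := y0 j ltj; rewrite e oppr_ge0 ler10.
Qed.

Lemma word_neg_simple l w i : (i < n)%N -> {in l, forall j, (j < n)%N} ->
  nonneg (ract w (alpha i)) -> nonneg (- ract (word_prod l) (ract w (alpha i))) ->
  exists l1 j l2, [/\ l = l1 ++ j :: l2 &
    ract (word_prod l2) (ract w (alpha i)) = alpha j].
Proof.
move=> lti; elim: l => [|j l IH] ltl y0.
  by rewrite big_nil ract1 => /(nonneg_antisym y0)/(root_neq0 lti).
have ltj : (j < n)%N by apply: ltl; apply: mem_head.
have ltl' : {in l, forall j, (j < n)%N}.
  by move=> k kl; apply: ltl; rewrite inE kl orbT.
rewrite big_cons ractM; have := root_cases (word_prod l * w)%g lti.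
rewrite ractM => -[ly|ly] gy.
  exists [::], j, l; split=> //; rewrite -ractM.
  by apply: nonneg_sref_eq; rewrite ?ractM.
have [l1 [k [l2 [-> e]]]] := IH ltl' y0 ly.
by exists (j :: l1), k, l2.
Qed.

(** While the letters of c are applied, the sign changes at some letter j, where the current root is
    [alpha j]. The letters of c to the left of j carry - [alpha j] to - [beta j]. *)
Lemma cox_neg w i : (i < n)%N -> nonneg (ract w (alpha i)) ->
  nonneg (- ract cox (ract w (alpha i))) ->
  exists2 j, (j < n)%N & ract cox (ract w (alpha i)) = - beta j.
Proof.
move=> lti y0; rewrite {1}cox_iota => /(word_neg_simple lti)[] //.
  by move=> j; rewrite mem_iota.
move=> l1 [j [l2 [e ey]]].
have sz_l : (size l1 + (size l2).+1 = n)%N.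
  by have := congr1 size e; rewrite size_iota size_cat.
have l1E : l1 = iota 0 (size l1).
  rewrite -[LHS](take_size_cat (j :: l2) (erefl (size l1))) -e take_iota.
  by congr iota; lia.
have jE : j = size l1.
  have := congr1 (nth 0%N ^~ (size l1)) e.
  by rewrite nth_cat ltnn subnn nth_iota //; lia.
have ltj : (j < n)%N by lia.
exists j => //; rewrite cox_iota e big_cat big_cons ractM ractM ey ract_gen_simple //.
rewrite ractN; congr (- _); rewrite /beta /cpre letters_small ?modn_small ?(ltnW ltj) //.
by rewrite l1E -jE.
Qed.

Lemma beta_cases p : nonneg (beta p) \/ nonneg (- beta p).
Proof. exact: root_cases (ltmod p). Qed.

Lemma beta1 p : E (beta p) (beta p) = 1.
Proof. by rewrite (euler1 Gs cox_fix cox_dot) // root1 // ltmod. Qed.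

Definition negroot p := [forall i : 'I_n, beta p i 0 <= 0].

Lemma negrootP p : reflect (nonneg (- beta p)) (negroot p).
Proof.
apply: (iffP forallP) => [neg i lti|neg [i lti]].
  by rewrite (scoefE lti) mxE oppr_ge0.
by have := neg i lti; rewrite (scoefE lti) mxE oppr_ge0.
Qed.

Lemma not_negroot p : ~~ negroot p -> nonneg (beta p).
Proof. by move/negrootP => Np; case: (beta_cases p). Qed.

Lemma nonneg_not_negroot p : nonneg (beta p) -> ~~ negroot p.
Proof.
by move=> p0; apply/negrootP => /(nonneg_antisym p0)/(root_neq0 (ltmod p)).
Qed.

(* The dead positions of c c c ... turn out to be those that the sorting word of
   the longest element skips. *)
Definition dead p :=
  has (fun q => (q %% n == p %% n)%N && negroot q) (iota 0 p.+1).

Lemma deadP p : reflect (exists q, [/\ (q <= p)%N, (q %% n = p %% n)%N & negroot q])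
  (dead p).
Proof.
apply: (iffP hasP) => [[q]|[q [leqp eqp nq]]].
  by rewrite mem_iota ltnS => leqp /andP[/eqP eqp nq]; exists q.
by exists q; rewrite ?eqp ?eqxx // mem_iota ltnS.
Qed.

Lemma alive_nonneg p : ~~ dead p -> nonneg (beta p).
Proof.
by move=> p_alive; apply: not_negroot; apply: contra p_alive => np; apply/deadP; exists p.
Qed.

(** Distinct simple roots have scalar product at most 0, so the coordinates of y other than those at
    s and t can only lower the value. *)
Lemma simple_cone_dot s t y : (s < n)%N -> (t < n)%N -> s != t ->
  nonneg y -> scoef s y = 0 -> scoef t y = 1 -> 
  dot (alpha s) y <= dot (alpha s) (alpha t).
Proof.
move=> lts ltt neqst y0 ys yt; rewrite {1}[y]simple_sum.
have -> : dot (alpha s) (\sum_(i < n) scoef i y *: alpha i) =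
    \sum_(i < n) scoef i y * dot (alpha s) (alpha i).
  apply: (big_ind2 (fun x a => dot (alpha s) x = a)) => [|x a x' b <- <-|i _].
  - by rewrite dot0r.
  - by rewrite dotDr.
  by rewrite dotZr.
rewrite (bigD1 (Ordinal ltt)) //= yt mul1r gerDl.
apply: sumr_le0 => i _; have [eis|neqis] := eqVneq s i.
  by rewrite -eis ys mul0r.
by rewrite mulr_ge0_le0 ?y0 // (dot_simple_le0 R WS cwS).
Qed.

(* If beta r is negative for the first time in its column then
   beta r = - beta j with j < n, so E y (beta r) is minus the j-th coefficient of
   y; but E (beta q') (beta r) > 0 for the next occurrence q' of a neighbouring
   letter, so beta q' is negative too. *)
Lemma dead_next p q : dead p -> (p < q)%N ->
  dot (alpha (p %% n)%N) (alpha (q %% n)%N) != 0 -> dead q.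
Proof.
move=> /deadP dead_p ltpq pqN0.
have [r [ler er nr] min_r] : exists2 r, [/\ (r <= p)%N, (r %% n = p %% n)%N & negroot r]
    & forall r', (r' < r)%N -> (r' %% n = p %% n)%N -> ~~ negroot r'.
  have ex_r : exists r, (r %% n == p %% n)%N && negroot r.
    by case: dead_p => r [_ e nr]; exists r; rewrite e eqxx.
  case: (ex_minnP ex_r) => r /andP[/eqP er nr] min_r; exists r.
    split=> //; case: dead_p => r' [le_r' e' nr'].
    by apply: leq_trans le_r'; apply: min_r; rewrite e' eqxx.
  move=> r' lt_r' e'; apply/negP => nr'; have := min_r r'.
  by rewrite e' eqxx nr' leqNgt lt_r' => /(_ isT).
have [es|neqst] := eqVneq (p %% n)%N (q %% n)%N.
  apply/deadP; exists r; split; last exact: nr.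
    exact: leq_trans ler (ltnW ltpq).
  by rewrite er es.
(* In the first turn the r-th coordinate of [beta r] is E(beta r, beta r) = 1, so this root is not
   negative. *)
have le_nr : (n <= r)%N.
  rewrite leqNgt; apply/negP => ltrn; move/negrootP: nr => /(_ r ltrn).
  by rewrite scoefN -(euler_beta_small _ ltrn) beta1; lra.
have [j ltj ej] : exists2 j, (j < n)%N & beta r = - beta j.
  have r0 : nonneg (beta (r - n)).
    by apply/not_negroot/min_r; [lia | rewrite -er -{2}(subnKC le_nr) modnDl].
  rewrite -(subnKC le_nr) beta_shift; apply: (cox_neg (ltmod _)) => //.
  by rewrite -[ract (cpre _) _]/(beta (r - n)) -beta_shift subnKC //; apply/negrootP.
set s := (p %% n)%N in neqst pqN0 er; set t := (q %% n)%N in neqst pqN0.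
(* q' is the first position after r that carries the letter t; it does not exceed q because r <
   q. *)
pose k := ((q - r) %% n)%N; pose q' := (r + k)%N.
have ltrq : (r < q)%N := leq_ltn_trans ler ltpq.
have le_q' : (q' <= q)%N.
  by rewrite /q' -leq_subRL ?leq_mod // ltnW.
have eq' : (q' %% n = t)%N by rewrite /q' /k modnDmr subnKC // ltnW.
have k_gt0 : (0 < k)%N.
  rewrite lt0n; apply: contraNneq neqst => k0.
  by rewrite -eq' /q' k0 addn0 er.
have ltkn : (k < n)%N := ltmod _.
pose u := letters r.+1 k.-1; pose y := ract (word_prod u) (alpha t).
have ltu : {in u, forall j, (j < n)%N} by apply: letters_lt.
have su : s \notin u by rewrite -er letters_notin // (leq_ltn_trans (leq_pred _)).
have tu : t \notin u.
  apply/mapP => -[i]; rewrite mem_iota => /andP[ltri ltik] /eqP.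
  move: ltik; rewrite addSnnS prednK // -/q' => ltiq'.
  rewrite -eq' (eqn_mod_dvd _ (ltnW ltiq')) => /dvdn_leq.
  rewrite subn_gt0 ltiq' => /(_ isT)/leq_trans/(_ (leq_sub2l q' (ltnW ltri))).
  by rewrite /q' addKn leqNgt ltkn.
have [lts ltt] : (s < n)%N /\ (t < n)%N by split; apply: ltmod.
have ys : scoef s y = 0.
  by rewrite scoef_word // scoef_simple // (negPf neqst).
have yt : scoef t y = 1 by rewrite scoef_word // scoef_simple // eqxx.
have y0 : nonneg y.
  by case: (root_cases (word_prod u) ltt) => // /(_ t ltt); rewrite scoefN yt; lra.
have q'E : beta q' = ract (cpre r) (ract (g s) y).
  rewrite /beta eq' /q' cpreD ractM -{1}(prednK k_gt0) -[letters r _]/(_ :: u) er.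
  by rewrite big_cons ractM.
(* The value is the s-th coordinate of the reflected y, that is -2 B(alpha s, y), which is positive
   as s and t are neighbours. *)
have Eq' : 0 < E (beta q') (beta r).
  rewrite q'E euler_cpre er ract_gen // scoef_sref_same // ys.
  have := simple_cone_dot lts ltt neqst y0 ys yt.
  have := dot_simple_le0 R WS cwS lts ltt neqst.
  by move: pqN0 => /eqP; lra.
apply/deadP; exists q'; split=> //; apply: contraT => /not_negroot/(_ j ltj).
move: Eq'; rewrite ej -scaleN1r eulerZr euler_beta_small //; lra.
Qed.

Lemma sref_orth_comm i j : (i < n)%N -> (j < n)%N ->
  dot (alpha i) (alpha j) = 0 -> commute (g i) (g j).
Proof.
move=> lti ltj ij0; apply: ract_inj => x; rewrite !ractM !ract_gen // /gsref.
rewrite !dotBr !dotZr ij0 (dotC Gs (alpha j) (alpha i)) ij0 !mulr0 !subr0.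
by rewrite addrAC.
Qed.

Definition alive_word p := [seq (i %% n)%N | i <- iota 0 p & ~~ dead i].
Definition vpre p : W := word_prod (alive_word p).
Definition dead_word p := [seq (i %% n)%N | i <- iota 0 p & dead i].
Definition upre p : W := word_prod (dead_word p).

Lemma dead_word_orth p q i : (p <= q)%N -> ~~ dead q -> i \in dead_word p ->
  dot (alpha i) (alpha (q %% n)%N) = 0.
Proof.
move=> lepq q_alive /mapP[r]; rewrite mem_filter mem_iota => /andP[dr /andP[_ ltrp]] ->.
apply/eqP; apply: contraNT q_alive; apply: dead_next dr _.
exact: leq_trans ltrp lepq.
Qed.

Lemma filter_word_lt (P : pred nat) p k :
  {in [seq (i %% n)%N | i <- iota p k & P i], forall j, (j < n)%N}.
Proof. by move=> j /mapP[i _ ->]; apply: ltmod. Qed.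

Lemma upre_comm p q : (p <= q)%N -> ~~ dead q -> commute (upre p) (g (q %% n)%N).
Proof.
move=> lepq q_alive; apply/commute_sym.
rewrite /upre big_seq; apply: (big_ind (commute (g (q %% n)%N))) => [|x y|i ip].
- exact: commute1.
- exact: commuteM.
apply: sref_orth_comm; rewrite ?ltmod ?(filter_word_lt ip) // (dotC Gs).
exact: dead_word_orth q_alive ip.
Qed.

Lemma upre_fix p q : (p <= q)%N -> ~~ dead q ->
  ract (upre p) (alpha (q %% n)%N) = alpha (q %% n)%N.
Proof.
move=> lepq q_alive; apply: ract_word_fix; first exact: filter_word_lt.
by move=> i; apply: dead_word_orth q_alive.
Qed.

Lemma alive_wordS p : alive_word p.+1 =
  alive_word p ++ (if dead p then [::] else [:: (p %% n)%N]).
Proof.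
by rewrite /alive_word -addn1 iotaD filter_cat map_cat /= add0n; case: dead.
Qed.

Lemma dead_wordS p : dead_word p.+1 =
  dead_word p ++ (if dead p then [:: (p %% n)%N] else [::]).
Proof.
by rewrite /dead_word -addn1 iotaD filter_cat map_cat /= add0n; case: dead.
Qed.

Lemma vpre_alive p : ~~ dead p -> vpre p.+1 = (vpre p * g (p %% n)%N)%g.
Proof. by move=> /negPf dp; rewrite /vpre alive_wordS dp big_cat big_seq1. Qed.

Lemma vpre_dead p : dead p -> vpre p.+1 = vpre p.
Proof. by move=> dp; rewrite /vpre alive_wordS dp cats0. Qed.

(** A skipped letter commutes with every later kept letter, so all skipped letters can be pushed to
    the right end. *)
Lemma cpre_vu p : cpre p = (vpre p * upre p)%g.
Proof.
elim: p => [|p IH]; first by rewrite /cpre /vpre /upre !big_nil mulg1.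
rewrite cpreS IH; have [dp|dp] := boolP (dead p).
  by rewrite vpre_dead // /upre dead_wordS dp big_cat big_seq1 mulgA.
rewrite vpre_alive // {2}/upre dead_wordS (negPf dp) cats0 -/(upre p).
by rewrite -!mulgA (upre_comm (leqnn p)).
Qed.

Lemma alive_beta q : ~~ dead q -> beta q = ract (vpre q) (alpha (q %% n)%N).
Proof. by move=> q_alive; rewrite /beta cpre_vu ractM upre_fix. Qed.

Lemma word_S l : {in l, forall j, (j < n)%N} -> {subset [seq g i | i <- l] <= S}.
Proof. by move=> ltl s /mapP[i /ltl lti ->]; exact: (gen_S cwS lti). Qed.

Lemma len_word_prod l : {in l, forall j, (j < n)%N} ->
  (len (word_prod l) <= size l)%N.
Proof.
by move=> /word_S lS; have := len_prod WS lS; rewrite big_map size_map.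
Qed.

(** The kept letters form a reduced word: the root at an alive position is positive, so appending
    its letter increases the length. *)
Lemma len_vpre p : len (vpre p) = size (alive_word p).
Proof.
elim: p => [|p IH]; first by rewrite /vpre big_nil len1.
have [dp|dp] := boolP (dead p).
  by rewrite vpre_dead // alive_wordS dp cats0.
rewrite alive_wordS (negPf dp) size_cat -IH addn1 vpre_alive //.
apply/eqP; rewrite eqn_leq lenMS ?(gen_S cwS) ?ltmod //= nonneg_len ?ltmod //.
by rewrite -alive_beta //; apply: alive_nonneg.
Qed.

(** The sum of x over the powers of d is fixed by d, hence zero; if all its terms had nonnegative
    coordinates, they would vanish, and x is one of them. *)
Lemma expg_act_nonneg d x : (forall y, ract d y = y -> y = 0) -> x <> 0 ->
  [exists k : 'I_#[d]%g, exists i : 'I_n, ract (d ^+ k)%g x i 0 < 0].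
Proof.
move=> d_fix x_neq0; apply: contraT; rewrite negb_exists => /forallP dx0.
have {}dx0 k i : (k < #[d]%g)%N -> (i < n)%N -> 0 <= scoef i (ract (d ^+ k)%g x).
  move=> ltk lti; have := dx0 (Ordinal ltk); rewrite negb_exists.
  by move/forallP/(_ (Ordinal lti)); rewrite -leNgt (scoefE lti).
pose F k := ract (d ^+ k)%g x.
have F_S k : ract d (F k) = F k.+1 by rewrite -ractM -expgS.
have sum0 : \sum_(k < #[d]%g) F k = 0.
  apply: d_fix; rewrite ract_sum.
  have := expg_order d; have := order_gt0 d.
  case: #[d]%g => // o _ ordd.
  rewrite big_ord_recr [RHS]big_ord_recl /= F_S /F ordd expg0 addrC.
  by congr (_ + _); apply: eq_bigr => k _; rewrite F_S.
case: x_neq0; apply: scoefP => i lti; rewrite scoef0.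
have := congr1 (scoef i) sum0; rewrite scoef_sum scoef0.
have F0 (k : 'I_#[d]%g) : predT k -> 0 <= scoef i (F k).
  by move=> _; apply: dx0.
by move/(psumr_eq0P F0)/(_ (Ordinal (order_gt0 d)) isT); rewrite /F expg0 ract1.
Qed.

Lemma beta_mul k j : beta (k * n + j) = ract (cox ^+ k)%g (beta j).
Proof.
elim: k => [|k IH]; first by rewrite mul0n add0n expg0 ract1.
by rewrite mulSn -addnA beta_shift IH -ractM expgS.
Qed.

(** Apply the inverse of c until the root x becomes negative. By [cox_neg], the last positive root
    met is some [beta j] with j < n, so x is the root k turns below it in the same column. All roots
    between them are positive, so the position is alive. *)
Lemma positive_root_alive w i : (i < n)%N -> nonneg (ract w (alpha i)) ->
  exists2 q, ~~ dead q & beta q = ract w (alpha i).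
Proof.
move=> lti x0; set x := ract w (alpha i); pose d := (cox^-1)%g.
pose P k := [exists i : 'I_n, ract (d ^+ k)%g x i 0 < 0].
have d_fix y : ract d y = y -> y = 0.
  by move=> dy; apply: cox_fix; rewrite -{1}dy ractVK.
have exP : exists k, P k.
  have /existsP[k Pk] := expg_act_nonneg d_fix (@root_neq0 w i lti).
  by exists k.
have notP k : ~~ P k -> nonneg (ract (d ^+ k)%g x).
  move=> /existsPn Pk j ltj; have := Pk (Ordinal ltj).
  by rewrite -leNgt (scoefE ltj).
have [k Pk min_k] := ex_minnP exP.
case: k => [|k] in Pk min_k.
  case/existsP: Pk => -[j ltj]; rewrite expg0 ract1 => neg.
  by have := x0 j ltj; rewrite (scoefE ltj) leNgt neg.
have xk0 l : (l <= k)%N -> nonneg (ract (d ^+ l)%g x).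
  by move=> lelk; apply: notP; apply/negP => /min_k; rewrite leqNgt ltnS lelk.
(* The factor [g i] changes the sign, so that the opposite of the negative root is again an image of
   [alpha i], as [cox_neg] requires. *)
pose w' := (d ^+ k.+1 * w * g i)%g.
have w'E : ract w' (alpha i) = - ract (d ^+ k.+1)%g x.
  by rewrite !ractM ract_gen_simple // !ractN.
have w'0 : nonneg (ract w' (alpha i)).
  rewrite w'E -ractM; have [dx0|//] := root_cases (d ^+ k.+1 * w)%g lti.
  case/existsP: Pk => -[j ltj].
  by have := dx0 j ltj; rewrite ractM (scoefE ltj) leNgt => /negPf ->.
have cw'E : ract cox (ract w' (alpha i)) = - ract (d ^+ k)%g x.
  by rewrite w'E ractN expgS ractM ractVK.
have [|j ltj] := cox_neg lti w'0; first by rewrite cw'E opprK; apply: xk0.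
rewrite cw'E => /oppr_inj xE.
have qE l : (l <= k)%N -> beta (l * n + j) = ract (d ^+ (k - l))%g x.
  move=> lelk; rewrite beta_mul -xE -ractM; congr ract.
  rewrite -{1}(subnKC lelk) expgD mulgA /d expVgn mulgV mul1g //.
exists (k * n + j)%N; last by rewrite qE // subnn expg0 ract1.
apply/deadP => -[r [ler er]]; apply/negP.
have rE : r = ((r %/ n) * n + j)%N.
  by rewrite {1}(divn_eq r n) er modnMDl modn_small.
have ler' : (r %/ n <= k)%N.
  have := leq_div2r n ler; rewrite divnMDl // [(j %/ n)%N]divn_small // addn0 //.
by apply: nonneg_not_negroot; rewrite rE qE //; apply: xk0; apply: leq_subr.
Qed.

(** Every orbit of roots under c contains a negative root, so no column survives as many turns as
    the order of c. *)
Definition horizon := (#[cox]%g * n)%N.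

Lemma dead_horizon q : (horizon <= q)%N -> dead q.
Proof.
move=> leMq; have ltj := ltmod q.
have /existsP[k /existsP[[i lti] neg]] :=
  expg_act_nonneg cox_fix (@root_neq0 (cpre (q %% n)%N) _ ltj).
apply/deadP; exists (k * n + q %% n)%N; split.
- apply: leq_trans leMq; rewrite /horizon.
  have := ltn_ord k; nia.
- by rewrite modnMDl modn_mod.
apply: contraT => /not_negroot/(_ i lti); rewrite beta_mul (scoefE lti).
by rewrite /beta modn_mod leNgt neg.
Qed.

Lemma reduced_cat l1 l2 : {in l1 ++ l2, forall j, (j < n)%N} ->
  len (word_prod (l1 ++ l2)) = size (l1 ++ l2) ->
  len (word_prod l1) = size l1 /\ len (word_prod l2) = size l2.
Proof.
move=> ltl; rewrite big_cat size_cat => e.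
have ltl1 : {in l1, forall j, (j < n)%N}.
  by move=> j jl; apply: ltl; rewrite mem_cat jl.
have ltl2 : {in l2, forall j, (j < n)%N}.
  by move=> j jl; apply: ltl; rewrite mem_cat jl orbT.
have := lenM WS (word_prod l1) (word_prod l2); rewrite e.
have := len_word_prod ltl1; have := len_word_prod ltl2.
by move: (len _) (len _) => a b; lia.
Qed.

Definition alive_between p k :=
  [seq (i %% n)%N | i <- iota p k & ~~ dead i].

Lemma alive_split p k : ~~ dead p ->
  alive_word (p + k.+1) = alive_word p ++ (p %% n)%N :: alive_between p.+1 k.
Proof.
move=> p_alive; rewrite /alive_word iotaD filter_cat map_cat add0n /=.
by rewrite p_alive.
Qed.

Lemma alive_word_lt p : {in alive_word p, forall j, (j < n)%N}.
Proof. exact: filter_word_lt. Qed.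

Lemma alive_word_reduced p : len (word_prod (alive_word p)) = size (alive_word p).
Proof. exact: len_vpre. Qed.

Lemma ract_combination_neg d x : (forall i, (i < n)%N -> nonneg (- ract d (alpha i))) ->
  nonneg x -> nonneg (- ract d x).
Proof.
move=> d_neg x0; rewrite [x]simple_sum ract_sum -sumrN.
apply: big_ind => [i lti|y z|i _]; first by rewrite scoef0.
- exact: nonnegD.
by rewrite ractZ -scalerN; apply: nonnegZ; [apply: x0 | apply: d_neg].
Qed.

Lemma simple_not_neg i : (i < n)%N -> ~ nonneg (- alpha i).
Proof.
move=> lti /(_ i lti); rewrite scoefN scoef_simple // eqxx.
by rewrite oppr_ge0 ler10.
Qed.

Lemma ract_inv_neg d : (forall i, (i < n)%N -> nonneg (- ract d (alpha i))) ->
  forall i, (i < n)%N -> nonneg (- ract d^-1%g (alpha i)).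
Proof.
move=> d_neg i lti; case: (root_cases d^-1%g lti) => // di0.
by have := ract_combination_neg d_neg di0; rewrite ractVK => /(simple_not_neg lti).
Qed.

(** Otherwise the image of [alpha i] is positive, hence [beta q] for a kept position q. Cancelling
    the letters up to q shows that the remaining word l sends [alpha i] to minus the simple root at
    q, whereas q followed by l is reduced. *)
Lemma vpre_horizon_neg i : (i < n)%N -> nonneg (- ract (vpre horizon) (alpha i)).
Proof.
move=> lti; case: (root_cases (vpre horizon) lti) => //.
move=> /[dup] pos /(positive_root_alive lti)[q q_alive].
have ltqM : (q < horizon)%N.
  by rewrite ltnNge; apply: contra q_alive; apply: dead_horizon.
have := alive_word_lt (p := horizon); have := alive_word_reduced horizon.
rewrite alive_beta // /vpre -[horizon](subnKC ltqM) addSnnS alive_split //.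
set l := alive_between _ _ => l_red ltl.
have [|_] := reduced_cat _ l_red; first exact: ltl.
rewrite big_cat /= ractM => l_red' /(can_inj (ractK _)) e.
move: e; rewrite big_cons ractM => e.
have ltq := ltmod q.
have Le : ract (word_prod l) (alpha i) = - alpha (q %% n)%N.
  by rewrite -(ract_gen_simple ltq) {1}e -ractM gK // ract1.
have Lq : ract (word_prod l)^-1%g (alpha (q %% n)%N) = - alpha i.
  by rewrite -[alpha (q %% n)%N]opprK -Le ractN ractK.
case: (simple_not_neg lti); rewrite -Lq; apply: ract_simple_nonneg => //.
have ltl' : {in l, forall j, (j < n)%N} by apply: filter_word_lt.
have -> : ((word_prod l)^-1 * g (q %% n)%N)%g = (word_prod ((q %% n)%N :: l))^-1%g.
  by rewrite /= big_cons invMg gV.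
by rewrite !lenV l_red' /= leqW // len_word_prod.
Qed.

Lemma longest_neg w0 i : longest_element S w0 -> (i < n)%N ->
  nonneg (- ract w0 (alpha i)).
Proof.
move=> [u /(reduced_wordP WS)[_ _ sz_u] u_max] lti; apply: ract_simple_nonpos => //.
have [v [vS vw sz_v]] := len_word WS (w0 * g i)%g.
rewrite -sz_u -sz_v; apply: (u_max (w0 * g i)%g).
exact/(reduced_wordP WS).
Qed.

(** Both elements make every simple root negative, so the inverse of one times the other keeps all
    of them positive and is 1. *)
Lemma vpre_longest w0 : longest_element S w0 -> vpre horizon = w0.
Proof.
move=> w0S; apply/esym/(mulgI (vpre horizon)^-1%g); rewrite mulVg.
apply: ract_nonneg_eq1 => i lti; rewrite ractM -[ract w0 _]opprK ractN.
apply: ract_combination_neg; last exact: longest_neg.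
exact/ract_inv_neg/vpre_horizon_neg.
Qed.

Definition alive_positions := [seq p <- iota 0 horizon | ~~ dead p].

Lemma alive_positions_sorted : sorted ltn alive_positions.
Proof. exact/(sorted_filter ltn_trans)/iota_ltn_sorted. Qed.

Lemma map_cinf ps : map (cinf cw) ps = map g [seq (p %% n)%N | p <- ps].
Proof. by rewrite -map_comp. Qed.

Lemma mod_lt ps : {in [seq (p %% n)%N | p <- ps], forall j, (j < n)%N}.
Proof. by move=> j /mapP[p _ ->]; apply: ltmod. Qed.

Section Sorting.
Variable w0 : W.
Hypothesis w0S : longest_element S w0.

Lemma reduced_alive_positions : reduced_word S w0 (map (cinf cw) alive_positions).
Proof.
apply/(reduced_wordP WS); rewrite map_cinf; split.
- exact/word_S/mod_lt.
- by rewrite big_map; apply: vpre_longest.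
rewrite size_map -/(alive_word horizon) -alive_word_reduced.
by rewrite -(vpre_longest w0S).
Qed.

(* A dead letter cannot be inserted: its column does not reappear in the rest of
   the word of w0, which therefore keeps the corresponding root positive. *)
Lemma alive_positions_lex pre l qs : sorted ltn (pre ++ qs) ->
  reduced_word S w0 (map (cinf cw) (pre ++ qs)) -> alive_positions = pre ++ l ->
  (l <= qs :> Order.SeqLexiOrder.Exports.seqlexi nat)%O.
Proof.
elim: l pre qs => [|a l IH] pre qs qs_sorted qs_red Tl; first exact: lexi0s.
have [_ _ szT] := (reduced_wordP WS _ _).1 reduced_alive_positions.
have [_ wq szq] := (reduced_wordP WS _ _).1 qs_red.
case: qs => [|b qs] in qs_sorted qs_red wq szq *.
  by move: szT; rewrite Tl -szq !size_map !size_cat /=; lia.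
rewrite lexi_cons !leEnat; case: (ltngtP a b) => //= [ltba|eab].
  have T_sorted := alive_positions_sorted.
  have mem_le i : i \in a :: l -> (a <= i)%N.
    rewrite inE => /orP[/eqP->//|il]; move: T_sorted.
    rewrite Tl => /(subseq_sorted ltn_trans (suffix_subseq _ _)) /=.
    by move/(order_path_min ltn_trans)/allP/(_ i il)/ltnW.
  have b_dead : dead b.
    apply: contraT => b_alive.
    have: b \in alive_positions.
      rewrite mem_filter b_alive mem_iota /= (ltn_trans ltba) //.
      have: a \in alive_positions by rewrite Tl mem_cat mem_head orbT.
      by rewrite mem_filter mem_iota => /andP[_ /andP[]].
    rewrite Tl mem_cat => /orP[b_pre|/mem_le]; last by rewrite leqNgt ltba.
    move: qs_sorted; rewrite (sorted_pairwise ltn_trans) pairwise_cat.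
    by case/andP=> /allrelP/(_ b b b_pre (mem_head _ _)); rewrite ltnn.
  pose lv := [seq (p %% n)%N | p <- pre]; pose ly := [seq (p %% n)%N | p <- a :: l].
  have w0E : w0 = (word_prod lv * word_prod ly)%g.
    have [_ <- _] := (reduced_wordP WS _ _).1 reduced_alive_positions.
    by rewrite Tl map_cinf map_cat big_map big_cat.
  have b_ly : (b %% n)%N \notin ly.
    apply/mapP => -[i il e]; have : i \in alive_positions by rewrite Tl mem_cat il orbT.
    rewrite mem_filter => /andP[/negP[]]; have /deadP[r [ler er nr]] := b_dead.
    apply/deadP; exists r; split; rewrite ?er //.
    by rewrite (leq_trans ler) // (leq_trans (ltnW ltba)) // mem_le.
  have v_pos : nonneg (ract (word_prod lv) (alpha (b %% n)%N)).
    apply: ract_simple_nonneg; first exact: ltmod.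
    have ltq := mod_lt (ps := pre ++ b :: qs).
    move: szq; rewrite -wq map_cinf size_map big_map.
    rewrite -cat_rcons map_cat in ltq *; move/esym/(reduced_cat ltq) => [] + _.
    rewrite map_rcons -cats1 big_cat big_seq1 size_cat addn1 -/lv => ->.
    by rewrite leqW // len_word_prod //; apply: mod_lt.
  have := ract_combination_neg (ract_inv_neg (fun i => longest_neg w0S)) v_pos.
  rewrite w0E invMg ractM ractK => /(_ _ (ltmod b)).
  have -> : scoef (b %% n)%N (- ract (word_prod ly)^-1%g (alpha (b %% n)%N)) = -1.
    rewrite scoefN -[scoef _ _](@scoef_word _ ly) ?ractVK ?ltmod //; last exact: mod_lt.
    by rewrite scoef_simple ?ltmod // eqxx.
  by rewrite oppr_ge0 ler10.
apply: (IH (rcons pre a)); rewrite ?cat_rcons // eab //.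
Qed.

Lemma sorting_word_positions sw : sorting_word S cw w0 sw ->
  sw = map (cinf cw) alive_positions.
Proof.
move=> [ps [ps_sorted -> ps_red ps_min]]; congr map.
apply: (@le_anti _ (Order.SeqLexiOrder.Exports.seqlexi nat)).
rewrite ps_min ?alive_positions_sorted //=; last exact: reduced_alive_positions.
exact: (@alive_positions_lex [::]).
Qed.

End Sorting.

(** Factors of a reduced word are reduced, and the last root of a reduced word is positive; this is
    applied to the kept letters up to q, starting just after p and at p. *)
Lemma alive_pair_root p k : ~~ dead p -> ~~ dead (p + k.+1) ->
  let q := (p + k.+1)%N in
  let z := ract (word_prod (alive_between p.+1 k)) (alpha (q %% n)%N) in
  [/\ nonneg z, nonneg (ract (g (p %% n)%N) z) &
      beta q = ract (vpre p) (ract (g (p %% n)%N) z)].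
Proof.
move=> p_alive q_alive q z; have [ltp ltq] := (ltmod p, ltmod q).
set l := alive_between p.+1 k in z *.
have q_red := alive_word_reduced q.+1; have q_lt := alive_word_lt (p := q.+1).
rewrite alive_wordS (negPf q_alive) alive_split // -/l -catA /= in q_red q_lt.
have [_ pq_red] := reduced_cat q_lt q_red.
have pq_lt : {in (p %% n)%N :: l ++ [:: (q %% n)%N], forall j, (j < n)%N}.
  by move=> j jl; apply: q_lt; rewrite mem_cat jl orbT.
have lq_lt : {in l ++ [:: (q %% n)%N], forall j, (j < n)%N}.
  by move=> j jl; apply: pq_lt; rewrite inE jl orbT.
have [_ lq_red] := reduced_cat (l1 := [:: (p %% n)%N]) pq_lt pq_red.
have l_lt : {in l, forall j, (j < n)%N} by apply: filter_word_lt.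
split.
- apply: ract_simple_nonneg => //.
  have -> : (word_prod l * g (q %% n)%N)%g = word_prod (l ++ [:: (q %% n)%N]).
    by rewrite /= big_cat big_seq1.
  by rewrite lq_red size_cat addn1 leqW // len_word_prod.
- rewrite -ractM; apply: ract_simple_nonneg => //.
  have -> : (g (p %% n)%N * word_prod l * g (q %% n)%N)%g =
      word_prod ((p %% n)%N :: l ++ [:: (q %% n)%N]).
    by rewrite /= big_cons big_cat big_seq1 mulgA.
  rewrite pq_red /= size_cat addn1 leqW // (leq_trans (lenM _ _ _)) //.
  rewrite -add1n leq_add ?len_word_prod // len_S //; exact: (gen_S cwS ltp).
rewrite alive_beta // /vpre /q alive_split // -/l big_cat big_cons /= !ractM //.
Qed.

Lemma upre_between p k x : ~~ dead p ->
  ract (upre p) (ract (word_prod (alive_between p k)) x) =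
  ract (word_prod (alive_between p k)) (ract (upre p) x).
Proof.
move=> p_alive; rewrite -!ractM; congr ract; apply/esym/commute_sym.
rewrite /= big_seq; apply: (big_ind (commute (upre p))) => [|u v|i].
- exact: commute1.
- exact: commuteM.
case/mapP=> q; rewrite mem_filter mem_iota => /andP[q_alive /andP[lepq _]] ->.
exact: upre_comm.
Qed.

(* The skipped letters commute past every alive letter, so the pair can be moved
   to where the earlier root is the first simple root. *)
Lemma euler_alive p q : ~~ dead p -> ~~ dead q -> (p < q)%N ->
  E (beta p) (beta q) <= 0 /\ 0 <= E (beta q) (beta p).
Proof.
move=> p_alive q_alive ltpq; have ltp := ltmod p.
have [k qE] : exists k, q = (p + k.+1)%N by exists (q - p.+1)%N; lia.
rewrite qE in q_alive *; set q' := (p + k.+1)%N in q_alive *.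
have [] := alive_pair_root p_alive q_alive.
rewrite -/q'; set z := ract _ (alpha (q' %% n)%N) => z0 gz0 qE'.
have gzE : ract (g (p %% n)%N) z =
    ract (word_prod (alive_between p k.+1)) (alpha (q' %% n)%N).
  by rewrite /alive_between /= p_alive /= big_cons ractM.
have q'E : beta q' = ract (cpre p) (ract (g (p %% n)%N) z).
  rewrite qE' cpre_vu ractM; congr ract; rewrite gzE upre_between // upre_fix //.
  by rewrite /q' leq_addr.
have Eqp : E (beta q') (beta p) = scoef (p %% n)%N (ract (g (p %% n)%N) z).
  by rewrite q'E euler_cpre.
split; last by rewrite Eqp; apply: gz0.
(* While E(beta q, beta p) is the coordinate of the reflected z, E(beta p, beta q) comes out as
   minus the coordinate of z. *)
have := euler_sym Gs cox_fix cox_dot (beta p) (beta q').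
rewrite Eqp {2}q'E /beta ract_dot -/(beta p) -/(beta q').
have : scoef (p %% n)%N z >= 0 by apply: z0.
have -> : scoef (p %% n)%N z = scoef (p %% n)%N (ract (g (p %% n)%N) z)
    - 2 * dot (alpha (p %% n)%N) (ract (g (p %% n)%N) z).
  by rewrite -scoef_sref_same // -ract_gen // -ractM gK // ract1.
by lra.
Qed.

Lemma ract_conj w i x : (i < n)%N ->
  ract (w * g i * w^-1)%g x = sref (ract w (alpha i)) x.
Proof.
move=> lti; rewrite !ractM ract_gen // /gsref ractB ractZ ractVK.
by rewrite -[dot (alpha i) _](ract_dot w) ractVK.
Qed.

Lemma sref_eq b b' : dot b b = 1 -> dot b' b' = 1 ->
  (forall x, sref b x = sref b' x) -> b = b' \/ b = - b'.
Proof.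
move=> b1 b'1 /(_ b); rewrite {1}/gsref b1 /gsref mulr1 => e.
have {}e : b = dot b' b *: b'.
  apply/(scalerI (a := 2)); first by rewrite pnatr_eq0.
  apply: (addrI (- b)); apply: oppr_inj.
  by rewrite scalerA !opprD !opprK.
have := b1; rewrite {1 2}e (dotZl Gs) dotZr b'1 mulr1 => /eqP.
rewrite -expr2 sqrf_eq1 => /orP[/eqP a1'|/eqP a1']; rewrite e a1'.
  by left; rewrite scale1r.
by right; rewrite scaleN1r.
Qed.

Lemma alive_beta_inj p q : ~~ dead p -> ~~ dead q -> beta p = beta q -> p = q.
Proof.
move=> p_alive q_alive e; case: (ltngtP p q) => // ltpq.
  by have [] := euler_alive p_alive q_alive ltpq; rewrite -e beta1 ler10.
by have [] := euler_alive q_alive p_alive ltpq; rewrite -e beta1 ler10.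
Qed.

Lemma nonneg_unit_eq p q : ~~ dead p -> ~~ dead q ->
  (forall x, sref (beta p) x = sref (beta q) x) -> p = q.
Proof.
move=> p_alive q_alive e; apply: alive_beta_inj => //.
have [||//|e'] := sref_eq _ _ e; rewrite ?root1 ?ltmod //.
have := alive_nonneg p_alive; rewrite e'.
by move/(nonneg_antisym (alive_nonneg q_alive))/(root_neq0 (ltmod q)).
Qed.

(** * The reflection order *)

Section ReflectionWord.
Variables (w0 : W) (sw : seq W).
Hypotheses (w0S : longest_element S w0) (swS : sorting_word S cw w0 sw).

Local Notation Rc := (reflection_word sw).
Local Notation T := alive_positions.

Lemma size_Rc : size Rc = size T.
Proof.
by rewrite /reflection_word size_map size_iota (sorting_word_positions w0S swS) size_map.
Qed.

Lemma alive_positions_uniq : uniq T.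
Proof. exact/filter_uniq/iota_uniq. Qed.

Lemma nth_alive i : (i < size T)%N -> ~~ dead (nth 0%N T i).
Proof. by move/(mem_nth 0%N); rewrite mem_filter => /andP[]. Qed.

Lemma alive_position_index q : ~~ dead q ->
  exists2 i, (i < size T)%N & nth 0%N T i = q.
Proof.
move=> q_alive; exists (index q T); last rewrite nth_index //; rewrite ?index_mem.
all: rewrite mem_filter q_alive mem_iota /= add0n ltnNge.
all: by apply: contra q_alive; apply: dead_horizon.
Qed.

Lemma take_alive_positions i : (i < size T)%N ->
  take i T = [seq p <- iota 0 (nth 0%N T i) | ~~ dead p].
Proof.
move=> ltiT; set q := nth 0%N T i.
have q_alive : ~~ dead q := nth_alive ltiT.
have ltqM : (q < horizon)%N.
  by rewrite ltnNge; apply: contra q_alive; apply: dead_horizon.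
set T1 := filter _ _.
have TE : T = T1 ++ q :: [seq p <- iota q.+1 (horizon - q.+1) | ~~ dead p].
  rewrite /alive_positions -{1}[horizon](subnKC ltqM) addSnnS iotaD filter_cat.
  by rewrite add0n /= q_alive.
have iE : i = size T1.
  rewrite -(index_uniq 0%N ltiT alive_positions_uniq) -/q TE index_cat.
  by rewrite {1}/T1 mem_filter mem_iota ltnn !andbF /= eqxx addn0.
by rewrite TE iE take_size_cat.
Qed.

Lemma nth_Rc i : (i < size T)%N -> let q := nth 0%N T i in
  nth 1%g Rc i = (vpre q * g (q %% n)%N * (vpre q)^-1)%g.
Proof.
move=> ltiT q; have swE := sorting_word_positions w0S swS.
have ltisw : (i < size sw)%N by rewrite swE size_map.
rewrite (nth_map 0%N) ?size_iota // nth_iota // add0n.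
have swP : (\prod_(s <- take i sw) s)%g = vpre q.
  by rewrite swE -map_take take_alive_positions // map_cinf big_map.
rewrite (prod_rev_S WS) ?swP; last first.
  move=> s /mem_take; rewrite swE map_cinf; apply: word_S; exact: mod_lt.
by rewrite swE (nth_map 0%N).
Qed.

Definition rootv (t : W) := beta (nth 0%N T (index t Rc)).

Lemma rootv_nth i : (i < size T)%N -> forall x,
  ract (nth 1%g Rc i) x = sref (beta (nth 0%N T i)) x.
Proof.
move=> ltiT x; rewrite nth_Rc // ract_conj ?ltmod //.
by rewrite alive_beta ?nth_alive.
Qed.

Lemma Rc_uniq : uniq Rc.
Proof.
apply/(uniqP 1%g) => i j; rewrite !inE size_Rc => lti ltj e.
apply/eqP; rewrite -(nth_uniq 0%N lti ltj alive_positions_uniq); apply/eqP.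
apply: nonneg_unit_eq; rewrite ?nth_alive // => x.
by rewrite -!rootv_nth // e.
Qed.

Lemma index_Rc t : t \in Rc -> (index t Rc < size T)%N.
Proof. by rewrite -index_mem size_Rc. Qed.

Lemma ract_rootv t x : t \in Rc -> ract t x = sref (rootv t) x.
Proof.
move=> tRc; rewrite -{1}(nth_index 1%g tRc) rootv_nth //.
exact: index_Rc.
Qed.

Lemma rootv_alive t : t \in Rc -> ~~ dead (nth 0%N T (index t Rc)).
Proof. by move=> /index_Rc/nth_alive. Qed.

Lemma rootv1 t : dot (rootv t) (rootv t) = 1.
Proof. by rewrite root1 ?ltmod. Qed.

(** Replacing w by w times [g i] keeps the reflection and negates its root, which may thus be taken
    positive; every positive root sits at an alive position. *)
Lemma conj_in_Rc w i : (i < n)%N -> (w * g i * w^-1)%g \in Rc.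
Proof.
move=> lti; wlog w0' : w / nonneg (ract w (alpha i)).
  move=> pos; case: (root_cases w lti) => [|neg]; first exact: pos.
  have := pos (w * g i)%g; rewrite ractM ract_gen_simple // ractN => /(_ neg).
  by rewrite invMg gV // -!mulgA (mulgA (g i) (g i)) gK // mul1g.
have [q q_alive qE] := positive_root_alive lti w0'.
have [k ltkT kE] := alive_position_index q_alive.
rewrite (_ : (w * _ * _)%g = nth 1%g Rc k) ?mem_nth ?size_Rc //.
by apply: ract_inj => x; rewrite ract_conj // -qE rootv_nth // kE.
Qed.

Lemma Rc_reflections : Rc =i reflections S.
Proof.
move=> t; apply/idP/imset2P => [tRc|[s y sS _ ->]].
  have ltiT := index_Rc tRc; set q := nth 0%N T (index t Rc).
  exists (g (q %% n)%N) (vpre q)^-1%g; rewrite ?inE ?(gen_S cwS) ?ltmod //.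
  by rewrite -{1}(nth_index 1%g tRc) nth_Rc // conjgE invgK mulgA.
have [i lti ->] := S_gen cwS sS.
by rewrite conjgE mulgA -{2}[y]invgK conj_in_Rc.
Qed.

Lemma ract_word_Rc rs x : {subset rs <= Rc} ->
  ract (\prod_(r <- rs) r)%g x = foldr sref x [seq rootv r | r <- rs].
Proof.
elim: rs => [|r rs IH] rsRc; first by rewrite big_nil ract1.
rewrite big_cons ractM IH /= => [|t trs]; last by apply: rsRc; rewrite inE trs orbT.
by rewrite ract_rootv // rsRc // mem_head.
Qed.

(** c is not a product of fewer than n reflections: these would have a common orthogonal vector,
    which c would fix. *)
Lemma reduced_Rc rs : {subset rs <= Rc} ->
  reduced_word (reflections S) cox rs <->
  size rs = n /\ (\prod_(r <- rs) r)%g = cox.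
Proof.
have size_ge us : {subset us <= Rc} -> (\prod_(r <- us) r)%g = cox -> (n <= size us)%N.
  move=> usRc usc; rewrite leqNgt; apply/negP => lt_us.
  have [|x xN0 x_orth] := exists_orthogonal Gs (bs := map rootv us).
    by rewrite size_map.
  case/eqP: xN0; apply: cox_fix; rewrite -usc ract_word_Rc //.
  exact: foldr_sref_fix.
have cw_sub : {subset cw <= reflections S}.
  move=> s scw; apply/imset2P; exists s 1%g; rewrite ?inE ?conjg1 //.
  by rewrite -(proj2 cwS).
move=> rsRc; split=> [[_ rsc rs_min]|[rsn rsc]].
  split=> //; apply/eqP; rewrite eqn_leq size_ge // andbT.
  exact: (rs_min cw).
split=> // [t /rsRc|us usA usc]; first by rewrite Rc_reflections.
by rewrite rsn; apply: size_ge => // t /usA; rewrite Rc_reflections.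
Qed.

Lemma rootv_nth1 rs i : (i < size rs)%N ->
  rootv (nth 1%g rs i) = nth 0 [seq rootv r | r <- rs] i.
Proof. by move=> lti; rewrite (nth_map 1%g). Qed.

Lemma triangular_Rc rs : {subset rs <= Rc} ->
  reduced_word (reflections S) cox rs <->
  size rs = n /\ forall i j, (i < j < n)%N ->
    E (rootv (nth 1%g rs j)) (rootv (nth 1%g rs i)) = 0.
Proof.
move=> rsRc; have rs1 : {in [seq rootv r | r <- rs], forall b, dot b b = 1}.
  by move=> b /mapP[r _ ->]; apply: rootv1.
rewrite reduced_Rc //; split=> -[rsn h]; split=> //.
  move=> i j /andP[ltij ltjn]; rewrite !rootv_nth1 ?rsn ?(ltn_trans ltij) //.
  apply: (euler_factor Gs cox_fix); rewrite ?size_map ?ltij // => x.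
  by rewrite -ract_word_Rc // h.
apply: ract_inj => x; rewrite ract_word_Rc //.
apply: (triangular_prod Gs cox_fix cox_dot rs1); rewrite ?size_map // => i j.
by case/andP=> ltij ltjn; rewrite -!rootv_nth1 ?rsn ?(ltn_trans ltij) ?h ?ltij.
Qed.

Lemma reflection_word_euler_roots :
  euler_roots (reflections S) cox Rc E rootv.
Proof.
split.
- exact: (eulerDl Gs).
- exact: (eulerZl Gs).
- exact: eulerDr.
- exact: eulerZr.
- exact: Rc_uniq.
- exact: Rc_reflections.
- move=> r rRc; apply: ract_inj => x; rewrite ract1 ractM !ract_rootv //.
  by rewrite srefK ?rootv1.
- by move=> r _; rewrite (euler1 Gs cox_fix cox_dot) // rootv1.
- move=> r t rRc tRc ltrt; apply: euler_alive; rewrite ?rootv_alive //.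
  have := alive_positions_sorted; rewrite (sorted_pairwise ltn_trans).
  by move/(pairwiseP 0%N); apply; rewrite ?inE ?index_Rc.
- move=> r t rRc tRc; have rtrRc : (r * t * r)%g \in Rc.
    move: tRc; rewrite !Rc_reflections => /imset2P[s y sS _ ->].
    apply/imset2P; exists s (y * r)%g; rewrite ?inE //.
    rewrite conjgM [RHS]conjgE -mulgA; congr (_ * _)%g; apply/esym/mulg1_eq.
    by apply: ract_inj => x; rewrite ract1 ractM !ract_rootv // srefK ?rootv1.
  split=> //=; rewrite (euler_sym Gs cox_fix cox_dot).
  apply: sref_eq; rewrite ?rootv1 //.
    by rewrite -[X in dot X]/(sref (rootv r) (rootv t)) sref_dot ?rootv1.
  move=> x; rewrite -ract_rootv // !ractM !ract_rootv // -[_ - _]/(sref _ _).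
  by rewrite sref_conj ?rootv1.
- exact: triangular_Rc.
move=> rs u rsRc /(triangular_Rc rsRc)[rsn tri].
have rs1 : {in [seq rootv r | r <- rs], forall b, dot b b = 1}.
  by move=> b /mapP[r _ ->]; apply: rootv1.
have [|i j|f ->] := triangular_span Gs cox_fix cox_dot rs1 _ _ u.
- by rewrite size_map.
- by case/andP=> ltij ltjn; rewrite -!rootv_nth1 ?rsn ?(ltn_trans ltij) ?tri ?ltij.
by exists f; apply: eq_bigr => i _; rewrite rootv_nth1 ?rsn.
Qed.

End ReflectionWord.
End CoxeterPowers.

End GeometricAction.

(** * Colored reflections and rotations *)

Section ColoredPositions.
Variables (W : finGroupType) (Rc : seq W) (m : nat).
Local Notation letter := ('I_m.+1 * W)%type.
Local Notation N := (size Rc).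
Local Notation word := (colored_word Rc m).

Implicit Types a b : letter.

(** The position in R(c)^(m+1) in arithmetic form, so that passing to the next color adds exactly
    N. *)
Definition pos (a : letter) := a.1 * N + index a.2 Rc.

Lemma index_allpairs (T1 T2 : eqType) (s : seq T1) (t : seq T2) x y :
  x \in s -> y \in t ->
  index (x, y) [seq (x, y) | x <- s, y <- t] = index x s * size t + index y t.
Proof.
move=> + yt; elim: s => //= z s IH; rewrite inE index_cat.
have [<- _|neqxz /= xs] := eqVneq x z.
  by rewrite ?eqxx mul0n add0n map_f // index_map // => u v [].
rewrite ?(eq_sym z) ?(negPf neqxz) mulSn -addnA -IH // ifN ?size_map //.
by apply/mapP => -[u _ [exz]]; rewrite exz eqxx in neqxz.
Qed.

Lemma mem_word a : (a \in word) = (a.2 \in Rc).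
Proof.
case: a => i r /=; apply/allpairsP/idP => [[[j t] /= [_ tRc [_ ->]]] //|rRc].
by exists (i, r); split; rewrite ?mem_enum.
Qed.

Lemma word_uniq : uniq Rc -> uniq word.
Proof.
move=> Rc_uniq; apply: allpairs_uniq => //; first exact: enum_uniq.
by case=> ? ? [].
Qed.

Lemma index_word a : a.2 \in Rc -> index a word = pos a.
Proof.
case: a => i r /= rRc; rewrite index_allpairs ?mem_enum //.
by rewrite index_enum_ord.
Qed.

Lemma index_lt a : a.2 \in Rc -> index a.2 Rc < N.
Proof. by rewrite index_mem. Qed.

Lemma pos_inj a b : a.2 \in Rc -> b.2 \in Rc -> pos a = pos b -> a = b.
Proof.
move=> aRc bRc; rewrite -!index_word // => e.
by rewrite -(nth_index a (_ : a \in word)) ?mem_word // e nth_index ?mem_word.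
Qed.

Lemma pos_bound a : a.2 \in Rc -> a.1 * N <= pos a < a.1.+1 * N.
Proof.
by move=> /index_lt ltN; rewrite /pos leq_addr mulSn addnC ltn_add2r.
Qed.

Lemma colored_ltE a b : a.2 \in Rc -> b.2 \in Rc ->
  colored_lt Rc a b = (pos a < pos b).
Proof. by move=> aRc bRc; rewrite /colored_lt !index_word. Qed.

Lemma val_recolor (a : letter) : a.1 < m -> (recolor a).1 = a.1.+1 :> nat.
Proof. by move=> ltam; rewrite /= inordK // ltnS. Qed.

Lemma pos_recolor (a : letter) : a.1 < m -> pos (recolor a) = pos a + N.
Proof.
by move=> ltam; rewrite /pos val_recolor // mulSn -addnA addnC.
Qed.

Lemma insideE a b : a.2 \in Rc -> a.1 < m ->
  inside Rc a b = (b.2 \in Rc) && (pos a < pos b < pos a + N).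
Proof.
move=> aRc ltam; rewrite -pos_recolor // /inside.
have [bRc|bRc] := boolP (b.2 \in Rc); first by rewrite !colored_ltE.
apply/negbTE; rewrite negb_and; apply/orP; right.
rewrite /colored_lt -leqNgt (memNindex (x := b)) ?mem_word //.
exact: index_size.
Qed.

Lemma window_cases a b : a.2 \in Rc -> b.2 \in Rc -> pos a < pos b < pos a + N ->
  (a.1 = b.1 :> nat /\ index a.2 Rc < index b.2 Rc) \/
  (b.1 = a.1.+1 :> nat /\ index b.2 Rc < index a.2 Rc).
Proof.
move=> /index_lt lta /index_lt ltb; rewrite /pos.
move: (nat_of_ord a.1) (nat_of_ord b.1) (index a.2 Rc) (index b.2 Rc) lta ltb.
move=> i j x y ltx lty /andP[lt1 lt2].
have leij : i <= j.
  rewrite leqNgt; apply/negP => ltji.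
  have : j.+1 * N <= i * N by rewrite leq_mul2r ltji orbT.
  rewrite mulSn; lia.
have leji : j <= i.+1.
  rewrite leqNgt; apply/negP => ltij.
  have : i.+2 * N <= j * N by rewrite leq_mul2r ltij orbT.
  rewrite !mulSn; lia.
move: leij leji lt1 lt2; rewrite leq_eqVlt => /orP[/eqP <-|ltij leji].
  by move=> _ lt1 _; left; split=> //; lia.
have -> : j = i.+1 by lia.
by rewrite mulSn => _ lt2; right; split=> //; lia.
Qed.

Lemma window_lt p k x y : p < x < p + k -> p < y < p + k -> x < y -> x < y < x + k.
Proof. lia. Qed.

(** The colored copy of t between a and [recolor a], when t is not the reflection of a and the color
    of a is below m. *)
Definition copy (a : letter) (t : W) : letter :=
  if index a.2 Rc < index t Rc then (a.1, t) else recolor (a.1, t).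

Lemma copy2 a t : (copy a t).2 = t.
Proof. by rewrite /copy; case: ifP. Qed.

Lemma inside_copy a t : a.2 \in Rc -> a.1 < m -> t \in Rc -> t != a.2 ->
  inside Rc a (copy a t).
Proof.
move=> aRc ltam tRc neqta; rewrite insideE // copy2 tRc /= /copy.
have := index_lt (a := (a.1, t)) tRc; have := index_lt aRc; rewrite /=.
case: (ltngtP (index a.2 Rc) (index t Rc)) => [lt|gt|e] lta ltt.
- by rewrite /pos /=; lia.
- by rewrite pos_recolor //= /pos /=; lia.
by case/eqP: neqta; rewrite -(nth_index 1%g tRc) -e nth_index.
Qed.

Lemma inside_inj a b b' : a.2 \in Rc -> a.1 < m ->
  inside Rc a b -> inside Rc a b' -> b.2 = b'.2 -> b = b'.
Proof.
move=> aRc ltam; rewrite !insideE // => /andP[bRc wb] /andP[b'Rc wb'] e.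
apply: pos_inj => //; rewrite /pos e; congr (_ * _ + _).
by have := window_cases aRc bRc wb; have := window_cases aRc b'Rc wb'; rewrite e; lia.
Qed.

Lemma inside_neq a b : a.2 \in Rc -> a.1 < m -> inside Rc a b -> b.2 != a.2.
Proof.
move=> aRc ltam; rewrite insideE // => /andP[bRc wb].
apply/eqP => e; have := window_cases aRc bRc wb; rewrite e; lia.
Qed.

Lemma color_lt_of_pos a b : a.2 \in Rc -> b.2 \in Rc -> pos a + N <= pos b ->
  a.1 < m.
Proof.
move=> /pos_bound/andP[lea _] /pos_bound/andP[_ ltb] leab.
have : a.1.+1 * N < b.1.+1 * N.
  by rewrite (leq_ltn_trans _ ltb) // (leq_trans _ leab) // mulSn addnC leq_add2r.
by rewrite ltn_mul2r => /andP[_]; have := ltn_ord b.1; lia.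
Qed.

Lemma top_color_window a b : a.2 \in Rc -> b.2 \in Rc -> ~~ (a.1 < m) ->
  pos b < pos a + N.
Proof.
by move=> aRc bRc Nltam; rewrite ltnNge (contra _ Nltam) //; apply: color_lt_of_pos.
Qed.

End ColoredPositions.

(** * Factorizations as triangular sets of letters *)

Section Combinatorics.
Local Open Scope ring_scope.
Variables (R : realFieldType) (W : finGroupType) (S : {set W}) (cw : seq W).
Variables (Rc : seq W) (n m : nat) (E : 'cV[R]_n -> 'cV[R]_n -> R).
Variable root : W -> 'cV[R]_n.
Hypothesis er : euler_roots (reflections S) (\prod_(s <- cw) s)%g Rc E root.

Local Notation letter := ('I_m.+1 * W)%type.
Local Notation N := (size Rc).
Local Notation word := (colored_word Rc m).
Local Notation valid X := {in X, forall a : letter, a.2 \in Rc}.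
Local Notation factorization := (factorization S cw Rc).
Local Notation inside := (inside Rc).
Local Notation pos := (pos Rc).
Implicit Types (a b d e p x y z : letter) (X Y Z : {set letter}).

Let Rc_uniq := er_uniq er.

(* One full turn of R(c) is a change of sign, so that the copies of R(c) in
   R(c)^(m+1) behave like consecutive shifts in a derived category, and hom a b
   like the Euler characteristic of the homomorphisms from a to b. *)
Definition vec (a : letter) : 'cV[R]_n := (-1) ^+ a.1 *: root a.2.
Definition hom a b := E (vec b) (vec a).

Lemma homE a b : hom a b = (-1) ^+ a.1 * (-1) ^+ b.1 * E (root b.2) (root a.2).
Proof. by rewrite /hom /vec (erZl er) (erZr er) mulrA [_ ^+ b.1 * _]mulrC. Qed.

Lemma hom1 a : a.2 \in Rc -> hom a a = 1.
Proof. by move=> aRc; rewrite homE (er1 er) // mulr1 -expr2 sqrr_sign. Qed.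

Lemma vec_recolor a : (a.1 < m)%N -> vec (recolor a) = - vec a.
Proof.
by move=> ltam; rewrite /vec val_recolor //= exprS mulN1r scaleNr.
Qed.

Lemma ENl (u v : 'cV[R]_n) : E (- u) v = - E u v.
Proof. by rewrite -scaleN1r (erZl er) mulN1r. Qed.

Lemma ENr (u v : 'cV[R]_n) : E u (- v) = - E u v.
Proof. by rewrite -scaleN1r (erZr er) mulN1r. Qed.

Lemma hom_recolorl a b : (a.1 < m)%N -> hom (recolor a) b = - hom a b.
Proof. by move=> ltam; rewrite /hom vec_recolor // ENr. Qed.

Lemma hom_recolorr a b : (b.1 < m)%N -> hom a (recolor b) = - hom a b.
Proof. by move=> ltbm; rewrite /hom vec_recolor // ENl. Qed.

(** Within one color this is [er_sign]. For a letter of the next color the order of the two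
    reflections in R(c) is reversed and the sign of [vec] alternates, and the two changes
    compensate. *)
Lemma hom_sign a b : a.2 \in Rc -> b.2 \in Rc -> (pos a < pos b < pos a + N)%N ->
  0 <= hom a b /\ hom b a <= 0.
Proof.
move=> aRc bRc /(window_cases aRc bRc)[] [ecol ltab]; rewrite !homE.
  rewrite ecol -!expr2 !sqrr_sign !mul1r.
  by have [] := er_sign er aRc bRc ltab.
have [le0 ge0] := er_sign er bRc aRc ltab.
have sg (k : nat) : (-1) ^+ k * (-1) ^+ k = 1 :> R by rewrite -expr2 sqrr_sign.
by rewrite ecol exprS mulN1r !(mulrN, mulNr) sg !mul1r oppr_ge0 oppr_le0.
Qed.

Definition triangular X :=
  {in X &, forall a b, (pos a < pos b)%N -> hom a b = 0}.

Definition word_of X := [seq a <- word | a \in X].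

Lemma word_of_uniq X : uniq (word_of X).
Proof. exact/filter_uniq/word_uniq/Rc_uniq. Qed.

Lemma mem_word_of X : valid X -> word_of X =i X.
Proof.
move=> XRc a; rewrite mem_filter mem_word andb_idr //; exact: XRc.
Qed.

Lemma size_word_of X : valid X -> size (word_of X) = #|X|.
Proof.
move=> XRc; rewrite -(card_uniqP (word_of_uniq X)).
by apply: eq_card; apply: mem_word_of.
Qed.

Lemma word_of_sorted X a0 i j : (i < j < size (word_of X))%N ->
  (pos (nth a0 (word_of X) i) < pos (nth a0 (word_of X) j))%N.
Proof.
move=> /andP[ltij ltj].
have sorted_word : pairwise (relpre (index^~ word) ltn) word.
  apply/(pairwiseP a0) => k l; rewrite !inE => ltk ltl ltkl /=.
  by rewrite !index_uniq ?word_uniq.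
have := subseq_pairwise (filter_subseq (mem X) word) sorted_word.
move/(pairwiseP a0)/(_ i j); rewrite !inE (ltn_trans ltij ltj) ltj.
move=> /(_ isT isT ltij) /=; rewrite !index_word //.
- by have := mem_nth a0 ltj; rewrite mem_filter mem_word => /andP[].
by have := mem_nth a0 (ltn_trans ltij ltj); rewrite mem_filter mem_word => /andP[].
Qed.

Lemma hom_eq0 a b : (hom a b == 0) = (E (root b.2) (root a.2) == 0).
Proof.
by rewrite homE mulf_eq0 mulf_eq0 !signr_eq0.
Qed.

Lemma factorizationP X :
  factorization X <-> [/\ valid X, #|X| = n & triangular X].
Proof.
have sub X' : {subset [seq a.2 | a <- word_of X'] <= Rc}.
  by move=> r /mapP[a]; rewrite mem_filter mem_word => /andP[_ aRc] ->.
split=> [[XRc /(er_word er (sub X))[sz tri]]|[XRc sz tri]].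
  have {}XRc : valid X by move=> a /XRc; rewrite mem_word.
  rewrite size_map in sz; split=> //; first by rewrite -size_word_of.
  move=> a b aX bX ltab; apply/eqP; rewrite hom_eq0; apply/eqP.
  rewrite -(mem_word_of XRc) in aX; rewrite -(mem_word_of XRc) in bX.
  have [ia ib] : (index a (word_of X) < n)%N /\ (index b (word_of X) < n)%N.
    by rewrite -sz !index_mem.
  have ltij : (index a (word_of X) < index b (word_of X))%N.
    case: ltngtP => // [gt|e]; last first.
      by move: ltab; rewrite -(nth_index a aX) e nth_index // ltnn.
    have := @word_of_sorted X a _ _ (introT andP (conj gt _)).
    rewrite sz ia => /(_ isT); rewrite !nth_index // ltnNge.
    by rewrite (ltnW ltab).
  have := tri (index a (word_of X)) (index b (word_of X)).
  by rewrite ltij ib !(nth_map a) ?sz // !nth_index // => /(_ isT).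
split=> [a aX|]; first by rewrite mem_word; apply: XRc.
apply/(er_word er (sub X)); rewrite size_map size_word_of //.
split=> // i j /andP[ltij ltjn]; have sz' := size_word_of XRc.
have a0 : letter by exact: (ord0, 1%g).
have lti := ltn_trans ltij ltjn; rewrite !(nth_map a0) ?sz' ?sz //.
apply/eqP; rewrite -hom_eq0; apply/eqP/tri.
- by rewrite -(mem_word_of XRc) mem_nth // sz' sz.
- by rewrite -(mem_word_of XRc) mem_nth // sz' sz.
by apply: word_of_sorted; rewrite ltij sz' sz.
Qed.

Lemma factorization_span X u : factorization X ->
  exists f : letter -> R, u = \sum_(a in X) f a *: vec a.
Proof.
move=> fX; have [XRc sz _] := (factorizationP X).1 fX.
have [|f ->] := er_span er u _ fX.2.
  by move=> r /mapP[a]; rewrite mem_filter mem_word => /andP[_ aRc] ->.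
rewrite -/(word_of X).
exists (fun a => f (index a (word_of X)) * (-1) ^+ a.1).
have a0 : letter by exact: (ord0, 1%g).
have -> : \sum_(a in X) (f (index a (word_of X)) * (-1) ^+ a.1) *: vec a =
    \sum_(a <- word_of X) f (index a (word_of X)) *: root a.2.
  rewrite -(eq_big_seq _ (fun a _ => erefl)) big_uniq ?word_of_uniq //=.
  apply: eq_big => [a|a _]; first by rewrite mem_word_of.
  by rewrite /vec scalerA -mulrA -expr2 sqrr_sign mulr1.
rewrite (big_nth a0) size_word_of // sz big_mkord; apply: eq_bigr => i _.
by rewrite (nth_map a0) ?size_word_of ?sz // index_uniq ?word_of_uniq ?size_word_of ?sz.
Qed.

(* A reflection commuting with that of a cannot change sign: its conjugate
   would be the opposite signed root, which does not fit in the window. *)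
Lemma vec_conj a d e : a.2 \in Rc -> (a.1 < m)%N -> inside a d -> inside a e ->
  e.2 = (a.2 * d.2 * a.2)%g -> hom a d = 0 ->
  vec e = vec d - hom d a *: vec a.
Proof.
move=> aRc ltam in_d in_e e2 Fad.
move: (in_d) (in_e); rewrite !insideE // => /andP[dRc wd] /andP[eRc we].
have [Fad_ge0 Fda_le0] := hom_sign aRc dRc wd.
have [Fae_ge0 Fea_le0] := hom_sign aRc eRc we.
set k := hom d a; pose u := vec d - k *: vec a.
have sg (i : nat) : (-1) ^+ i * (-1) ^+ i = 1 :> R by rewrite -expr2 sqrr_sign.
have uE : u = (-1) ^+ d.1 *: (root d.2 -
    (E (root a.2) (root d.2) + E (root d.2) (root a.2)) *: root a.2).
  have -> : E (root d.2) (root a.2) = 0.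
    by apply/eqP; have := Fad; move/eqP; rewrite hom_eq0.
  rewrite /u /k homE addr0 /vec scalerBr !scalerA; congr (_ - _ *: _).
  by rewrite -[RHS]mul1r -[X in _ = X * _](sg a.1); ring.
have e_cases : vec e = u \/ vec e = - u.
  rewrite uE; have [_ /= ] := er_conj er aRc dRc; rewrite -e2.
  case=> root_e; rewrite /vec root_e -(signr_odd _ e.1) -(signr_odd _ d.1);
    case: (odd e.1); case: (odd d.1);
    rewrite ?expr0 ?expr1 ?scale1r ?scaleN1r ?opprK; by [left | right].
case: e_cases => [//|e_Nu].
have k0 : k = 0.
  apply/le_anti; rewrite Fda_le0 /=.
  have : hom a e = k by rewrite /hom e_Nu ENl /u (erDl er) ENl (erZl er _ (vec a))
    -/(hom a d) Fad -/(hom a a) hom1 // mulr1 add0r opprK.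
  by move=> <-.
have e_Nd : vec e = - vec d by rewrite e_Nu /u k0 scale0r subr0.
have FedN : hom e d = -1 by rewrite /hom e_Nd ENr -/(hom d d) hom1.
have FdeN : hom d e = -1 by rewrite /hom e_Nd ENl -/(hom d d) hom1.
exfalso; case: (ltngtP (pos d) (pos e)) => [lt|lt|/(pos_inj dRc eRc) ede].
+ by have [] := hom_sign dRc eRc (window_lt wd we lt);
    rewrite FdeN oppr_ge0 ler10.
+ by have [] := hom_sign eRc dRc (window_lt we wd lt);
    rewrite FedN oppr_ge0 ler10.
by have := hom1 eRc; rewrite -{2}ede FedN; lra.
Qed.

Section Rotation.
Variables (X : {set letter}) (a : letter).
Hypotheses (fX : factorization X) (aX : a \in X) (ltam : (a.1 < m)%N).

Let XRc : valid X. Proof. by case/factorizationP: fX. Qed.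
Let X_tri : triangular X. Proof. by case/factorizationP: fX. Qed.
Let aRc : a.2 \in Rc. Proof. exact: XRc. Qed.
Let raRc : (recolor a).2 \in Rc. Proof. exact: aRc. Qed.

Let pos_ra : pos (recolor a) = (pos a + N)%N.
Proof. exact: pos_recolor. Qed.

Lemma recolor_notin : recolor a \notin X.
Proof.
apply/negP => raX; have : hom a (recolor a) = 0.
  apply: X_tri => //; rewrite pos_ra -[ltnLHS]addn0 ltn_add2l.
  exact: leq_ltn_trans (index_lt aRc).
by rewrite hom_recolorr // hom1 // => /eqP; rewrite oppr_eq0 oner_eq0.
Qed.

Lemma inside_pos d : inside a d -> (pos a < pos d < pos a + N)%N.
Proof. by rewrite insideE // => /andP[]. Qed.

Lemma inside_valid d : inside a d -> d.2 \in Rc.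
Proof. by rewrite insideE // => /andP[]. Qed.

Lemma hom_inside0 d : d \in X -> inside a d -> hom a d = 0.
Proof. by move=> dX /inside_pos/andP[lt _]; apply: X_tri. Qed.

Lemma kept_pos x : x \in X -> x != a -> ~~ inside a x ->
  (pos x < pos a)%N \/ (pos a + N < pos x)%N.
Proof.
move=> xX neqxa; rewrite insideE // (XRc xX) /= negb_and -!leqNgt.
have neq_a : pos x != pos a.
  by apply: contra neqxa => /eqP/(pos_inj (XRc xX) aRc) ->.
have neq_ra : pos x != (pos a + N)%N.
  apply: contraNneq recolor_notin => e.
  by rewrite -(pos_inj (XRc xX) raRc) // pos_ra.
lia.
Qed.

Lemma rotateP x : reflect
  [\/ x = recolor a, [/\ x \in X, x != a & ~~ inside a x] |
     exists d, [/\ d \in X, inside a d, inside a x & x.2 = (a.2 * d.2 * a.2)%g]]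
  (x \in rotate Rc X a).
Proof.
rewrite !inE -orbA; apply: (iffP or3P) => [] [].
- by move/eqP; constructor 1.
- by case/andP=> xX /andP[]; constructor 2.
- case/andP=> in_x /existsP[d /andP[dX /andP[in_d /eqP x2]]].
  by constructor 3; exists d.
- by move->; constructor 1.
- by case=> xX neq nin; constructor 2; rewrite xX neq.
case=> d [dX in_d in_x x2]; constructor 3; rewrite in_x.
by apply/existsP; exists d; rewrite dX in_d x2 eqxx.
Qed.

Lemma conj_neq d : inside a d -> (a.2 * d.2 * a.2)%g != a.2.
Proof.
move=> in_d; apply: contra (inside_neq aRc ltam in_d) => /eqP e.
apply/eqP/(mulgI a.2)/(mulIg a.2).
by rewrite e (er_invol er aRc) mul1g.
Qed.

Lemma conj_inj (s t : W) : (a.2 * s * a.2 = a.2 * t * a.2)%g -> s = t.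
Proof. by move/mulIg/mulgI. Qed.

(* Two letters of the window may exchange their order; they are then orthogonal,
   because the same number is both nonnegative and nonpositive. *)
Lemma rotate_triangular : triangular (rotate Rc X a).
Proof.
move=> x y /rotateP[->|[xX neqxa ninx]|[d [dX in_d in_x x2]]]
  /rotateP[->|[yX neqya niny]|[e [eX in_e in_y y2]]] ltxy.
- by rewrite ltnn in ltxy.
- rewrite hom_recolorl // X_tri ?oppr0 //.
  by move: ltxy; rewrite pos_ra; apply: leq_ltn_trans; apply: leq_addr.
- by have := inside_pos in_y; move: ltxy; rewrite pos_ra; lia.
- rewrite hom_recolorr // X_tri ?oppr0 //.
  by have := kept_pos xX neqxa ninx; move: ltxy; rewrite pos_ra; lia.
- exact: X_tri.
- rewrite /hom (vec_conj aRc ltam in_e in_y y2 (hom_inside0 eX in_e)).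
  rewrite -scaleNr (erDl er) (erZl er _ (vec a)) -/(hom x e) -/(hom x a).
  have /andP[_ lty] := inside_pos in_y; have /andP[lte _] := inside_pos in_e.
  have ltxa : (pos x < pos a)%N.
    case: (kept_pos xX neqxa ninx) => // /ltn_trans/(_ ltxy).
    by rewrite ltnNge (ltnW lty).
  by rewrite (X_tri xX eX (ltn_trans ltxa lte)) (X_tri xX aX ltxa) mulr0 addr0.
- rewrite hom_recolorr // /hom (vec_conj aRc ltam in_d in_x x2 (hom_inside0 dX in_d)).
  rewrite -scaleNr (erDr er) (erZr er _ _ (vec a)) -/(hom a a) hom1 // mulr1 -/(hom d a).
  by rewrite subrr oppr0.
- rewrite /hom (vec_conj aRc ltam in_d in_x x2 (hom_inside0 dX in_d)).
  rewrite -scaleNr (erDr er) (erZr er _ _ (vec a)) -/(hom a y) -/(hom d y).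
  have /andP[ltx _] := inside_pos in_x; have /andP[_ ltd] := inside_pos in_d.
  have ltya : (pos a + N < pos y)%N.
    case: (kept_pos yX neqya niny) => // /(ltn_trans ltxy).
    by rewrite ltnNge (ltnW ltx).
  rewrite (X_tri dX yX (ltn_trans ltd ltya)) (X_tri aX yX (ltn_trans ltx ltxy)).
  by rewrite mulr0 addr0.
have Fx := vec_conj aRc ltam in_d in_x x2 (hom_inside0 dX in_d).
have Fy := vec_conj aRc ltam in_e in_y y2 (hom_inside0 eX in_e).
(* On letters u with hom a u = 0, the map u - hom(u, a) a preserves E: the terms containing the
   product of the two coefficients cancel. *)
have conjF u v p q : inside a u -> inside a v -> hom a u = 0 -> hom a v = 0 ->
    vec p = vec u - hom u a *: vec a -> vec q = vec v - hom v a *: vec a ->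
    hom p q = hom u v.
  move=> in_u in_v Fau Fav pE qE; rewrite /hom pE qE -!scaleNr.
  rewrite !(erDl er) !(erDr er) !(erZl er _ (vec a)) !(erZr er _ _ (vec a)).
  rewrite -/(hom u v) -/(hom a v) -/(hom u a) -/(hom a a) hom1 // Fav; ring.
have Fxy : hom x y = hom d e by apply: conjF => //; apply: hom_inside0.
have Fyx : hom y x = hom e d by apply: conjF => //; apply: hom_inside0.
have [xRc yRc] := (inside_valid in_x, inside_valid in_y).
have [dRc eRc] := (inside_valid in_d, inside_valid in_e).
have [wx wy] := (inside_pos in_x, inside_pos in_y).
have [wd we] := (inside_pos in_d, inside_pos in_e).
have [Fxy_ge0 Fyx_le0] : 0 <= hom x y /\ hom y x <= 0.
  by apply: hom_sign => //; exact: window_lt wx wy ltxy.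
case: (ltngtP (pos d) (pos e)) => [lt|gt|/(pos_inj dRc eRc) ede].
- by rewrite Fxy X_tri.
- have [_ le0] : 0 <= hom e d /\ hom d e <= 0.
    by apply: hom_sign => //; exact: window_lt we wd gt.
  by apply/le_anti; rewrite Fxy_ge0 Fxy le0.
by move: Fyx_le0; rewrite Fyx ede hom1 // ler10.
Qed.

(** Describes the rotation as the image of a map that is injective on X, which shows that the number
    of letters does not change. *)
Definition rotate_letter x := if x == a then recolor a else
  if inside a x then copy Rc a (a.2 * x.2 * a.2)%g else x.

Lemma inside_rotate_letter x : inside a x ->
  inside a (copy Rc a (a.2 * x.2 * a.2)%g).
Proof.
move=> in_x; apply: inside_copy => //; last exact: conj_neq.
by have [] := er_conj er aRc (inside_valid in_x).
Qed.

Lemma not_inside_a : ~~ inside a a.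
Proof. by apply/negP => /inside_pos; rewrite ltnn. Qed.

Lemma not_inside_recolor : ~~ inside a (recolor a).
Proof. by apply/negP => /inside_pos; rewrite pos_ra ltnn andbF. Qed.

Lemma rotateE : rotate Rc X a = rotate_letter @: X.
Proof.
apply/setP => y; apply/rotateP/imsetP => [[->|[yX neqya niny]|]|[x xX ->]].
- by exists a; rewrite // /rotate_letter eqxx.
- by exists y; rewrite // /rotate_letter (negPf neqya) (negPf niny).
- move=> [d [dX in_d in_y y2]]; exists d => //; rewrite /rotate_letter in_d.
  rewrite ifN; last by apply: contraTneq in_d => ->; exact: not_inside_a.
  apply: (inside_inj aRc ltam in_y (inside_rotate_letter in_d)).
  by rewrite copy2.
rewrite /rotate_letter; case: eqVneq => [_|neqxa]; first by constructor 1.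
case: ifPn => [in_x|nin]; last by constructor 2.
constructor 3; exists x; split=> //; last exact: copy2.
exact: inside_rotate_letter.
Qed.

Lemma rotate_letter_inj : {in X &, injective rotate_letter}.
Proof.
move=> x y xX yX; rewrite /rotate_letter.
have [->|neqxa] := eqVneq x a; have [->|neqya] := eqVneq y a => //.
- case: ifPn => [in_y e|_ e]; last by case/negP: recolor_notin; rewrite e.
  by case/negP: not_inside_recolor; rewrite e inside_rotate_letter.
- case: ifPn => [in_x e|_ e]; last by case/negP: recolor_notin; rewrite -e.
  by case/negP: not_inside_recolor; rewrite -e inside_rotate_letter.
case: ifPn => in_x; case: ifPn => in_y // e.
- apply: (inside_inj aRc ltam) => //; apply: conj_inj.
  by have := congr1 snd e; rewrite !copy2.
- by case/negP: in_y; rewrite -e inside_rotate_letter.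
by case/negP: in_x; rewrite e inside_rotate_letter.
Qed.

Lemma rotate_valid : valid (rotate Rc X a).
Proof.
move=> x /rotateP[->//|[xX _ _]|[d [_ _ in_x _]]]; first exact: XRc.
exact: inside_valid.
Qed.

Lemma rotate_factorization : factorization (rotate Rc X a).
Proof.
apply/factorizationP; split; [exact: rotate_valid | | exact: rotate_triangular].
rewrite rotateE card_in_imset; last exact: rotate_letter_inj.
by case/factorizationP: fX.
Qed.

Lemma rotate_ge x : x \in rotate Rc X a -> (pos x < pos a)%N -> x \in X.
Proof.
case/rotateP=> [->|[]//|[d [_ _ /inside_pos]]]; last by lia.
by rewrite pos_ra; lia.
Qed.

Lemma rotate_lt x : (pos x < pos a)%N -> (x \in rotate Rc X a) = (x \in X).
Proof.
move=> ltxa; apply/idP/idP => [/rotate_ge|xX]; first exact.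
apply/rotateP; constructor 2; split=> //.
  by apply: contraTneq ltxa => ->; rewrite ltnn.
by apply/negP => /inside_pos; lia.
Qed.

Lemma rotate_notin : a \notin rotate Rc X a.
Proof.
apply/rotateP => -[e|[_ /eqP]//|[d [_ _ in_a _]]].
  by move: aX; rewrite e (negPf recolor_notin).
by case/negP: not_inside_a.
Qed.

End Rotation.

(* In the language of simple-minded collections, this is the vanishing of all
   homomorphisms of negative degree from Y to X. *)
Definition noneg X Y :=
  forall x y, x \in X -> y \in Y -> (pos y + N <= pos x)%N -> hom y x = 0.

Lemma noneg_refl X : factorization X -> noneg X X.
Proof.
move=> /factorizationP[XRc _ X_tri] x y xX yX le_yx; apply: X_tri => //.
rewrite (leq_trans _ le_yx) // -[ltnLHS]addn0 ltn_add2l.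
exact: leq_ltn_trans (index_lt (XRc _ yX)).
Qed.

(** Let x in X lie in the window of a, a full turn or more after y, and let e replace x. As
    [recolor a] is then also a full turn after y, hom y a = 0, so hom y e = hom y x. If e has moved
    to less than a full turn after y, then hom y e >= 0; but x equals [recolor y] or lies in its
    window, so hom y x <= 0, and the common value is 0. *)
Lemma noneg_rotate X Y a : factorization X -> valid Y -> a \in X -> (a.1 < m)%N ->
  noneg (rotate Rc X a) Y -> noneg X Y.
Proof.
move=> fX YRc aX ltam LXY x y xX yY le_yx.
have [XRc _ _] := (factorizationP X).1 fX; have aRc := XRc _ aX.
have yRc := YRc _ yY; have xRc := XRc _ xX.
have raX : recolor a \in rotate Rc X a by apply/rotateP => //; constructor 1.
have Fya0 : (pos y + N <= pos a + N)%N -> hom y a = 0.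
  move=> le_ya; have := LXY _ y raX yY; rewrite pos_recolor // le_ya hom_recolorr //.
  by move=> /(_ isT)/eqP; rewrite oppr_eq0 => /eqP.
have [exa|neqxa] := eqVneq x a.
  by rewrite exa; apply: Fya0; rewrite -exa (leq_trans le_yx) // leq_addr.
have [in_x|nin_x] := boolP (inside a x); last first.
  by apply: LXY => //; apply/rotateP => //; constructor 2.
set e := copy Rc a (a.2 * x.2 * a.2)%g.
have in_e : inside a e := inside_rotate_letter fX aX ltam in_x.
have eRa : e \in rotate Rc X a.
  by apply/rotateP => //; constructor 3; exists x; split=> //; apply: copy2.
have Fax := hom_inside0 fX aX ltam xX in_x.
have /andP[ltax ltxa] := inside_pos fX aX ltam in_x.
have /andP[ltae ltea] := inside_pos fX aX ltam in_e.
have Fye : hom y e = hom y x.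
  rewrite /hom (vec_conj aRc ltam in_x in_e (copy2 _ _ _) Fax) -scaleNr.
  rewrite (erDl er) (erZl er _ (vec a)) -/(hom y a) Fya0 ?mulr0 ?addr0 //.
  exact: ltnW (leq_ltn_trans le_yx ltxa).
have [le_ye|lt_ey] := leqP (pos y + N) (pos e); first by rewrite -Fye LXY.
have ltya : (pos y < pos a)%N.
  by rewrite -(ltn_add2r N) (leq_ltn_trans le_yx).
have eRc := rotate_valid fX aX ltam eRa.
have [Fye_ge0 _] : 0 <= hom y e /\ hom e y <= 0.
  by apply: hom_sign => //; rewrite (ltn_trans ltya).
apply/le_anti; rewrite -{2}Fye Fye_ge0 andbT.
have ltym := color_lt_of_pos yRc xRc le_yx.
have ryRc : (recolor y).2 \in Rc by [].
have pos_ry : pos (recolor y) = (pos y + N)%N by exact: pos_recolor.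
move: le_yx; rewrite -pos_ry leq_eqVlt => /orP[/eqP/(pos_inj ryRc xRc) <-|lt_ryx].
  by rewrite hom_recolorr // hom1 // lerN10.
have [] : 0 <= hom (recolor y) x /\ hom x (recolor y) <= 0; last first.
  by rewrite hom_recolorl // oppr_ge0.
apply: hom_sign => //; rewrite lt_ryx pos_ry (ltn_trans ltxa) //.
by rewrite ltn_add2r (ltn_trans ltae).
Qed.

Lemma camb_le_noneg X Y : factorization Y -> camb_le S cw Rc X Y -> noneg X Y.
Proof.
(* With Z arbitrary, composed chains are handled without transitivity of [noneg]; at the end Z =
   Y. *)
move=> fY XY; suff: forall Z, valid Z -> noneg Y Z -> noneg X Z.
  by apply; [case/factorizationP: fY | apply: noneg_refl].
elim: XY => {X Y fY} [X Y [a [fX fY aX ltam ->]] Z ZRc|X //|X Y Z' _ XY _ YZ Z ZRc LZ].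
  exact: noneg_rotate.
by apply: XY => //; apply: YZ.
Qed.

(* If p could be added in front of Z, then expanding its root over Z, the
   coefficients before p vanish and those in the window after p are
   nonpositive, so that pairing with p gives 1 <= 0. *)
Lemma no_insertion Z p : factorization Z -> p.2 \in Rc -> p \notin Z ->
  (forall z, z \in Z -> (pos z < pos p)%N -> hom z p = 0) ->
  (forall z, z \in Z -> (pos p < pos z)%N ->
     (pos z < pos p + N)%N \/ hom p z = 0) -> False.
Proof.
move=> fZ pRc pZ Zlt Zgt; have [ZRc _ Z_tri] := (factorizationP Z).1 fZ.
have [f fE] := factorization_span (vec p) fZ.
have Fsum b : E (vec p) (vec b) = \sum_(z in Z) f z * hom b z.
  rewrite fE; apply: (big_ind2 (fun u c => E u (vec b) = c)) => [|u c v d <- <-|z _].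
  - by rewrite -(scale0r (vec b)) (erZl er _ (vec b)) mul0r.
  - by rewrite (erDl er).
  by rewrite (erZl er _ (vec z)).
(* Pairing with z determines the coefficients recursively along the word, because E is triangular on
   Z. *)
have fz z : z \in Z ->
    f z = hom z p - \sum_(y in Z | (pos y < pos z)%N) f y * hom z y.
  move=> zZ; have -> : hom z p = \sum_(y in Z) f y * hom z y by rewrite -Fsum.
  rewrite (bigD1 z) //= hom1 ?ZRc // mulr1 (bigID (fun y => (pos y < pos z)%N)) /=.
  rewrite [X in _ + (_ + X)]big1 => [|y /andP[/andP[yZ neqyz] ge]].
    rewrite addr0 -addrA -[LHS]addr0; congr (_ + _); apply/esym/eqP.
    rewrite subr_eq0; apply/eqP/eq_bigl => y; case: (y \in Z) => //=.
    by rewrite andbC; case: ltngtP => //=; case: eqVneq => // ->; rewrite ltnn.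
  rewrite Z_tri ?mulr0 //; rewrite ltn_neqAle leqNgt ge andbT.
  by apply: contra neqyz => /eqP/esym/(pos_inj (ZRc _ yZ) (ZRc _ zZ)) ->.
have neq_p z : z \in Z -> pos z != pos p.
  move=> zZ; apply: contra pZ => /eqP/(pos_inj (ZRc _ zZ) pRc) <- //.
have f0 z : z \in Z -> (pos z < pos p)%N -> f z = 0.
  have [k] := ubnP (pos z); elim: k z => // k IH z ltzk zZ ltzp.
  rewrite fz // Zlt // sub0r big1 ?oppr0 // => y /andP[yZ ltyz].
  rewrite IH ?mul0r //; first exact: leq_trans ltyz _.
  exact: ltn_trans ltyz ltzp.
have f_le0 z : z \in Z -> (pos p < pos z < pos p + N)%N -> f z <= 0.
  have [k] := ubnP (pos z); elim: k z => // k IH z ltzk zZ /andP[ltpz ltzp].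
  have wz : (pos p < pos z < pos p + N)%N by rewrite ltpz.
  have [_ Fzp] := hom_sign pRc (ZRc _ zZ) wz.
  rewrite fz // subr_le0 (le_trans Fzp) // sumr_ge0 // => y /andP[yZ ltyz].
  case: (ltngtP (pos y) (pos p)) => [ltyp|ltpy|e]; last first.
  - by have := neq_p y yZ; rewrite e eqxx.
  - have wyz : (pos y < pos z < pos y + N)%N.
      by rewrite ltyz (ltn_trans ltzp) // ltn_add2r.
    have [_ Fzy] := hom_sign (ZRc _ yZ) (ZRc _ zZ) wyz.
    apply: mulr_le0 => //; apply: IH => //.
      exact: leq_trans ltyz _.
    by rewrite ltpy (ltn_trans ltyz).
  by rewrite f0 // mul0r.
have := hom1 pRc; rewrite /hom Fsum => sum1.
suff: \sum_(z in Z) f z * hom p z <= 0 by rewrite sum1 ler10.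
apply: sumr_le0 => z zZ; case: (ltngtP (pos z) (pos p)) => [lt|gt|e]; last first.
- by have := neq_p z zZ; rewrite e eqxx.
- case: (Zgt z zZ gt) => [ltzp|->]; last by rewrite mulr0.
  have wz : (pos p < pos z < pos p + N)%N by rewrite gt.
  have [Fpz _] := hom_sign pRc (ZRc _ zZ) wz.
  by rewrite mulr_le0_ge0 // f_le0.
by rewrite f0 // mul0r.
Qed.

(** * The greedy algorithm *)

Section GreedyStep.
Variables (X Y : {set letter}) (p : letter).
Hypotheses (fX : factorization X) (fY : factorization Y) (LXY : noneg X Y).
Hypotheses (pRc : p.2 \in Rc)
  (XY_lt : forall b, (pos b < pos p)%N -> (b \in X) = (b \in Y)).

Let XRc : valid X. Proof. by case/factorizationP: fX. Qed.
Let YRc : valid Y. Proof. by case/factorizationP: fY. Qed.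
Let X_tri : triangular X. Proof. by case/factorizationP: fX. Qed.
Let Y_tri : triangular Y. Proof. by case/factorizationP: fY. Qed.

(** Otherwise p could be inserted into X: the letters of X before p belong to Y, which is triangular
    and contains p, and [noneg X Y] handles those of X a full turn or more after p. *)
Lemma first_difference : p \in Y -> p \in X.
Proof.
move=> pY; apply: contraT => pX; exfalso.
apply: (no_insertion fX pRc pX) => z zX ltz.
  by apply: Y_tri => //; rewrite -XY_lt.
by have [le|lt] := leqP (pos p + N) (pos z); [right; apply: LXY | left].
Qed.

(** Otherwise p could be inserted into Y: the letters of Y before p belong to X, and after a letter
    of color m no letter is a full turn away. *)
Lemma first_difference_color : p \in X -> p \notin Y -> (p.1 < m)%N.
Proof.
move=> pX pY; apply: contraT => top; exfalso.
apply: (no_insertion fY pRc pY) => z zY ltz.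
  by apply: X_tri => //; rewrite XY_lt.
by left; apply: top_color_window => //; apply: YRc.
Qed.

(** If y is before p, it also belongs to the rotated set, which is triangular. If y is after p, then
    x lies beyond [recolor p] and was not moved by the rotation. *)
Lemma noneg_rotate_first : p \in X -> p \notin Y -> noneg (rotate Rc X p) Y.
Proof.
move=> pX pY; have ltpm := first_difference_color pX pY.
have fX' := rotate_factorization fX pX ltpm.
have [X'Rc _ X'_tri] := (factorizationP _).1 fX'.
move=> x y xX' yY le_yx.
have ltyx : (pos y < pos x)%N.
  rewrite (leq_trans _ le_yx) // -[ltnLHS]addn0 ltn_add2l.
  exact: leq_ltn_trans (index_lt (YRc yY)).
case: (ltngtP (pos y) (pos p)) => [ltyp|ltpy|/(pos_inj (YRc yY) pRc) e].
- by apply: X'_tri => //; rewrite rotate_lt // XY_lt.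
- have ltpx : (pos p + N < pos x)%N by rewrite (leq_trans _ le_yx) // ltn_add2r.
  apply: LXY => //; move: xX' => /rotateP[e|[]//|].
    by move: ltpx; rewrite e pos_recolor // ltnn.
  move=> [d [_ _ /(inside_pos fX pX ltpm)/andP[_ ltx] _]].
  by move: ltpx; rewrite ltnNge (ltnW ltx).
by rewrite -e yY in pY.
Qed.

Lemma greedy_step_noneg : exists X', [/\ greedy_step Rc X Y p = Some X',
  factorization X' & noneg X' Y].
Proof.
rewrite /greedy_step !inE.
have fd := first_difference.
have [pX|pX] := boolP (p \in X); have [pY|pY] := boolP (p \in Y); rewrite /=.
- by exists X.
- rewrite first_difference_color //; exists (rotate Rc X p); split=> //.
    by apply: rotate_factorization => //; apply: first_difference_color.
  exact: noneg_rotate_first.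
- by have := fd pY; rewrite (negPf pX).
by exists X.
Qed.

End GreedyStep.

Lemma greedy_stepP X Y p X' : greedy_step Rc X Y p = Some X' ->
  (X' = X /\ (p \in X) = (p \in Y)) \/
  [/\ X' = rotate Rc X p, p \in X, (p.1 < m)%N & p \notin Y].
Proof.
rewrite /greedy_step !inE.
have [pX|pX] := boolP (p \in X); have [pY|pY] := boolP (p \in Y) => //=.
- by case=> <-; left.
- by case: ifP => // ltpm [<-]; right.
by case=> <-; left.
Qed.

(* The state of the greedy algorithm when the letters rs remain to be read. *)
Definition read_up_to (rs : seq letter) X Y :=
  forall b, b.2 \in Rc -> b \notin rs -> (b \in X) = (b \in Y).

Lemma word_suffix_pos ls p rs b : word = ls ++ p :: rs -> p.2 \in Rc ->
  b.2 \in Rc -> (b \notin p :: rs) = (pos b < pos p)%N.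
Proof.
move=> wE pRc bRc; have := word_uniq m Rc_uniq; rewrite wE cat_uniq /=.
case/and3P=> _ /norP[p_ls rs_ls] /andP[p_rs _].
have pE : pos p = size ls.
  by rewrite -(index_word pRc) wE index_cat (negPf p_ls) /= eqxx addn0.
have bE : pos b = index b (ls ++ p :: rs) by rewrite -wE index_word.
have b_word : b \in ls ++ p :: rs by rewrite -wE mem_word.
rewrite pE bE index_cat; move: b_word; rewrite mem_cat.
have [b_ls _|b_ls /= b_rs] := boolP (b \in ls); last first.
  by rewrite b_rs ltnNge leq_addr.
rewrite index_mem b_ls; apply/negP; rewrite inE => /orP[/eqP e|b_rs].
  by rewrite -e b_ls in p_ls.
by case/hasP: rs_ls; exists b.
Qed.

Lemma read_up_to_step ls p rs X Y X' : word = ls ++ p :: rs ->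
  factorization X -> read_up_to (p :: rs) X Y ->
  greedy_step Rc X Y p = Some X' -> read_up_to rs X' Y.
Proof.
move=> wE fX XY step b bRc b_rs.
have pRc : p.2 \in Rc by rewrite -mem_word wE mem_cat mem_head orbT.
have [->|neqbp] := eqVneq b p.
  case: (greedy_stepP step) => [[-> //]|[-> pX ltpm /negPf ->]].
  exact/negbTE/rotate_notin.
have b_prs : b \notin p :: rs by rewrite inE negb_or neqbp.
case: (greedy_stepP step) => [[-> _]|[-> pX ltpm _]]; first exact: XY.
have ltbp : (pos b < pos p)%N by rewrite -(word_suffix_pos wE).
by rewrite rotate_lt //; apply: XY.
Qed.

Lemma greedy_run_succeeds ls rs X Y : word = ls ++ rs ->
  factorization X -> factorization Y -> noneg X Y -> read_up_to rs X Y ->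
  greedy_run Rc X Y rs <> None.
Proof.
elim: rs ls X => [|p rs IH] ls X wE fX fY LXY XY //=.
have pRc : p.2 \in Rc by rewrite -mem_word wE mem_cat mem_head orbT.
have [|X' [step fX' LX'Y]] := @greedy_step_noneg X Y p fX fY LXY pRc.
  move=> b ltbp; have [bRc|bRc] := boolP (b.2 \in Rc).
    by apply: XY => //; rewrite (word_suffix_pos wE).
  have [XRc _ _] := (factorizationP X).1 fX; have [YRc _ _] := (factorizationP Y).1 fY.
  by apply/idP/idP => [/XRc|/YRc] /(negP bRc).
rewrite step; have := IH (rcons ls p) X'; rewrite cat_rcons => /(_ wE fX' fY LX'Y).
move/(_ (read_up_to_step wE fX XY step)).
by case: greedy_run.
Qed.

Lemma read_up_to_nil X Y : factorization X -> factorization Y ->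
  read_up_to [::] X Y -> X = Y.
Proof.
move=> /factorizationP[XRc _ _] /factorizationP[YRc _ _] XY; apply/setP => b.
have [bRc|bRc] := boolP (b.2 \in Rc); first exact: XY.
by apply/idP/idP => [/XRc|/YRc] /(negP bRc).
Qed.

(** The first conclusion controls [undup]: all sets reached after p has been read agree with Y at p,
    so a set rotated at p never recurs and only immediate repetitions are removed. The inclusion of
    [ps] in [rs] makes the rotated letters increase. *)
Lemma greedy_run_chain ls rs X Y Xs : word = ls ++ rs ->
  factorization X -> factorization Y -> read_up_to rs X Y ->
  greedy_run Rc X Y rs = Some Xs ->
  [/\ {in Xs, forall Z, read_up_to rs Z Y}, X \in Xs &
   exists ps Zs, [/\ undup Xs = X :: Zs, last X Zs = Y,
     rotation_path S cw Rc X ps Zs, sorted (colored_lt Rc (m := m)) ps &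
     {subset ps <= rs}]].
Proof.
elim: rs ls X Xs => [|p rs IH] ls X Xs wE fX fY XY /=.
  case=> <-; rewrite mem_head; split=> // [Z|].
    by rewrite inE => /eqP ->.
  by exists [::], [::]; split=> //; apply: read_up_to_nil.
case step: greedy_step => [X'|//]; case run: greedy_run => [Xs'|//] [<-].
have fX' : factorization X'.
  case: (greedy_stepP step) => [[-> //]|[-> pX ltpm _]].
  exact: rotate_factorization.
have X'Y := read_up_to_step wE fX XY step.
have [|Xs'Y X'Xs' [ps [Zs [undupE lastE path ps_sorted ps_rs]]]] :=
  IH (rcons ls p) X' Xs' _ fX' fY X'Y run; first by rewrite cat_rcons.
rewrite mem_head; split=> //.
  move=> Z; rewrite inE => /orP[/eqP -> //|/Xs'Y ZY] b bRc.
  by rewrite inE negb_or => /andP[_]; apply: ZY.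
case: (greedy_stepP step) => [[e _]|[e pX ltpm pY]].
  subst X'; exists ps, Zs; rewrite /= X'Xs'; split=> // q /ps_rs.
  by rewrite inE orbC => ->.
have pRc : p.2 \in Rc by rewrite -mem_word wE mem_cat mem_head orbT.
have p_rs : p \notin rs.
  by have := word_uniq m Rc_uniq; rewrite wE cat_uniq /= => /and3P[_ _ /andP[]].
exists (p :: ps), (X' :: Zs); split=> //=.
- rewrite ifN ?undupE //; apply/negP => /Xs'Y/(_ p pRc p_rs).
  by rewrite pX (negPf pY).
- rewrite path_min_sorted //; apply/allP => q /ps_rs q_rs.
  have qRc : q.2 \in Rc by rewrite -mem_word wE mem_cat inE q_rs !orbT.
  rewrite colored_ltE // ltn_neqAle leqNgt -(word_suffix_pos wE) // inE q_rs orbT andbT.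
  by apply: contraNneq p_rs => /(pos_inj pRc qRc) ->.
by move=> q; rewrite !inE => /orP[->//|/ps_rs ->]; rewrite orbT.
Qed.

Lemma read_up_to_word X Y : read_up_to word X Y.
Proof. by move=> b bRc; rewrite mem_word bRc. Qed.

Lemma greedy_chain X Y Xs : factorization X -> factorization Y ->
  greedy Rc X Y = Some Xs -> increasing_chain S cw Rc X Y Xs.
Proof.
move=> fX fY; rewrite /greedy; case run: greedy_run => [Xs'|//] [<-].
have [_ _ [ps [Zs [-> lastE path ps_sorted _]]]] :=
  @greedy_run_chain [::] word X Y Xs' erefl fX fY (@read_up_to_word X Y) run.
by exists ps, Zs.
Qed.

Lemma rotation_path_camb X ps Zs : rotation_path S cw Rc X ps Zs ->
  camb_le S cw Rc X (last X Zs).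
Proof.
elim: ps X Zs => [|p ps IH] X [|Z Zs] //=; first by move=> _; exact: rt_refl.
by case=> XZ /IH; apply: rt_trans; apply: rt_step; exists p.
Qed.

Lemma chain_prefix X ps Zs b : rotation_path S cw Rc X ps Zs ->
  all (fun p => pos b < pos p)%N ps -> (b \in last X Zs) = (b \in X).
Proof.
elim: ps X Zs => [|p ps IH] X [|Z Zs] //= [[fX _ pX ltpm ->] path] /andP[ltbp all_b].
by rewrite (IH _ _ path all_b) rotate_lt.
Qed.

Lemma rotation_path_valid X ps Zs : rotation_path S cw Rc X ps Zs ->
  {in ps, forall p, p.2 \in Rc}.
Proof.
elim: ps X Zs => [|p ps IH] X [|Z Zs] //= [[fX _ pX _ _] path] q.
rewrite inE => /orP[/eqP ->|]; last exact: IH path q.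
by have [XRc _ _] := (factorizationP X).1 fX; apply: XRc.
Qed.

Lemma rotation_path_head X p ps Zs : rotation_path S cw Rc X (p :: ps) Zs ->
  sorted (colored_lt Rc (m := m)) (p :: ps) ->
  [/\ p \in X, p \notin last X Zs &
      forall b, (pos b < pos p)%N -> (b \in last X Zs) = (b \in X)].
Proof.
move=> path; have pRc := rotation_path_valid path (mem_head p ps).
rewrite /= path_sortedE => [|? ? ?]; last exact: ltn_trans.
case/andP=> /allP lt_ps _.
have {}lt_ps : {in ps, forall q, (pos p < pos q)%N}.
  move=> q q_ps; have := lt_ps q q_ps; rewrite colored_ltE //.
  by apply: (rotation_path_valid path); rewrite inE q_ps orbT.
have prefix b : (pos b < pos p)%N -> (b \in last X Zs) = (b \in X).
  move=> ltbp; apply: chain_prefix path _; rewrite /= ltbp.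
  by apply/allP => q /lt_ps; apply: ltn_trans.
case: Zs path prefix => // Z Zs [[fX _ pX ltpm ->] path] prefix; split=> //=.
rewrite (chain_prefix path) ?rotate_notin //.
by apply/allP => q /lt_ps.
Qed.

(* The first rotated letter is the first difference of the two ends. *)
Lemma increasing_chain_unique X Y Xs Xs' :
  increasing_chain S cw Rc X Y Xs -> increasing_chain S cw Rc X Y Xs' -> Xs = Xs'.
Proof.
move=> [ps [Zs [-> eY path ps_sorted]]] [ps' [Zs' [-> eY' path' ps'_sorted]]].
congr cons; elim: ps X Zs ps' Zs' eY path ps_sorted eY' path' ps'_sorted.
  move=> X [|//] [|p ps'] Zs' /= eY _ _ eY' path' sorted'; first by case: Zs' path' eY'.
  have [pX pY _] := rotation_path_head path' sorted'.
  by rewrite eY' -eY pX in pY.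
move=> p ps IH X Zs [|q ps'] Zs' eY path psorted eY' path' sorted'.
  have [pX pY _] := rotation_path_head path psorted.
  by case: Zs' path' eY' => // _ eY'; rewrite eY -eY' pX in pY.
have [pX pY p_lt] := rotation_path_head path psorted.
have [qX qY q_lt] := rotation_path_head path' sorted'.
rewrite eY in pY p_lt; rewrite eY' in qY q_lt.
have epq : p = q.
  have pRc := rotation_path_valid path (mem_head p ps).
  have qRc := rotation_path_valid path' (mem_head q ps').
  case: (ltngtP (pos p) (pos q)) => [lt|lt|/(pos_inj pRc qRc) //].
    by rewrite q_lt ?pX in pY.
  by rewrite p_lt ?qX in qY.
case: Zs path eY => // Z Zs /= [[_ _ _ _ eZ] path] eY.
case: Zs' path' eY' => // Z' Zs' /= [[_ _ _ _ eZ'] path'] eY'.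
have eZZ' : Z' = Z by rewrite eZ eZ' epq.
rewrite eZZ' in path' eY' *; congr cons; apply: IH path _ eY' path' _ => //.
  exact: path_sorted psorted.
exact: path_sorted sorted'.
Qed.

Lemma camb_le_greedy X Y : factorization X -> factorization Y ->
  camb_le S cw Rc X Y -> greedy Rc X Y <> None.
Proof.
move=> fX fY /(camb_le_noneg fY) LXY; rewrite /greedy.
have := @greedy_run_succeeds [::] word X Y erefl fX fY LXY (@read_up_to_word X Y).
by case: greedy_run.
Qed.

Lemma camb_le_increasing_chain X Y : factorization X -> factorization Y ->
  [/\ camb_le S cw Rc X Y <-> (exists Xs, increasing_chain S cw Rc X Y Xs),
      camb_le S cw Rc X Y <-> greedy Rc X Y <> None &
      forall Xs, greedy Rc X Y = Some Xs -> increasing_chain S cw Rc X Y Xs /\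
        (forall Zs, increasing_chain S cw Rc X Y Zs -> Zs = Xs)].
Proof.
move=> fX fY.
have chain_camb Xs : increasing_chain S cw Rc X Y Xs -> camb_le S cw Rc X Y.
  by move=> [ps [Zs [_ <- path _]]]; apply: rotation_path_camb path.
have camb_greedy := camb_le_greedy fX fY.
have greedy_ex : greedy Rc X Y <> None -> exists Xs, increasing_chain S cw Rc X Y Xs.
  by case run: greedy => [Xs|//] _; exists Xs; apply: greedy_chain.
split.
- by split=> [/camb_greedy/greedy_ex|[Xs /chain_camb]].
- by split=> // /greedy_ex[Xs /chain_camb].
move=> Xs run; have chain := greedy_chain fX fY run.
by split=> // Zs chain'; apply: increasing_chain_unique chain' chain.
Qed.

End Combinatorics.

(** For the empty Coxeter word there are no positions to reduce modulo n; there are no reflections,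
    so the conditions on roots are empty. *)
Lemma euler_roots_rank0 (R : realFieldType) (W : finGroupType) (S : {set W})
    (cw sw : seq W) (w0 : W) :
  coxeter_word S cw -> sorting_word S cw w0 sw -> size cw = 0%N ->
  euler_roots (n := 0) (reflections S) (\prod_(s <- cw) s)%g (reflection_word sw)
    (fun _ _ => 0 : R)%R (fun _ => 0)%R.
Proof.
move=> [_ cwS] [ps [_ _ [swS _ _] _]] /size0nil cw0.
have S0 : S = set0 by apply/setP => s; rewrite -cwS cw0 inE.
have -> : sw = [::] by case: sw swS => // s sw /(_ s (mem_head _ _)); rewrite S0 inE.
have refl0 : reflections S = set0.
  by apply/setP => t; rewrite inE; apply/imset2P => -[s y]; rewrite S0 inE.
rewrite cw0 big_nil refl0; split => //=.
- by move=> _ _ _; rewrite addr0.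
- by move=> a _ _; rewrite mulr0.
- by move=> _ _ _; rewrite addr0.
- by move=> a _ _; rewrite mulr0.
- by move=> t; rewrite !inE.
- move=> [|r rs] sub; last by have := sub r (mem_head _ _); rewrite in_nil.
  by split=> // _; split=> //; rewrite big_nil.
by move=> rs u _ _; exists (fun _ => 0%R); rewrite big_ord0 [u]flatmx0.
Qed.

Lemma exists_euler_roots (R : realType) (W : finGroupType) (S : {set W})
    (cw sw : seq W) (w0 : W) :
  coxeter_system S -> coxeter_word S cw -> longest_element S w0 ->
  sorting_word S cw w0 sw ->
  exists n (E : 'cV[R]_n -> 'cV[R]_n -> R) root,
    euler_roots (reflections S) (\prod_(s <- cw) s)%g (reflection_word sw) E root.
Proof.
move=> WS cwS w0S swS; have [n0|n_gt0] := posnP (rank cw).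
  exists 0%N, (fun _ _ => 0 : R)%R, (fun _ => 0)%R.
  exact: euler_roots_rank0 cwS swS n0.
have [rho [rho1 rhoM rho_gen]] := geometric_rep R WS cwS.
exists (rank cw); do 2 eexists.
exact: (reflection_word_euler_roots WS cwS rho1 rhoM rho_gen n_gt0 w0S swS).
Qed.

Import GroupScope.

Theorem theorem4p7 (W : finGroupType) (S : {set W}) (cw : seq W) (w0 : W)
    (sw : seq W) (m : nat)
    (WS : coxeter_system S) (cwS : coxeter_word S cw)
    (w0S : longest_element S w0) (sw_w0 : sorting_word S cw w0 sw)
    (m_gt0 : 0 < m)
    (X Y : {set 'I_m.+1 * W})
    (factX : factorization S cw (reflection_word sw) X)
    (factY : factorization S cw (reflection_word sw) Y) :
  [/\ camb_le S cw (reflection_word sw) X Y <->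
        (exists Xs, increasing_chain S cw (reflection_word sw) X Y Xs),
      camb_le S cw (reflection_word sw) X Y <->
        greedy (reflection_word sw) X Y <> None &
      forall Xs, greedy (reflection_word sw) X Y = Some Xs ->
        increasing_chain S cw (reflection_word sw) X Y Xs /\
        (forall Zs, increasing_chain S cw (reflection_word sw) X Y Zs ->
           Zs = Xs)].
Proof.
have [n [E [root er]]] :=
  exists_euler_roots Rdefinitions.R WS cwS w0S sw_w0.
exact: (camb_le_increasing_chain er).
Qed.
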